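(* For every $h\in[0,\log 2)$ there exists a pair $(L_0,L_1)\in\mathcal{W}$ which has exactly one maximising measure, and this measure has metric (Kolmogorov–Sinai) entropy with respect to $\sigma$ equal to $h$.
   Context: Let $\mathcal{H}$ be a real separable Hilbert space with orthonormal basis $\{e_i: i\in\mathbb{Z}\}$, and let $\mathcal{B}(\mathcal{H})$ be the bounded linear operators on $\mathcal{H}$ with the operator norm topology. A weighted shift operator is a bounded linear operator $L$ on $\mathcal{H}$ such that $Le_i=\alpha_i e_{i+1}$ for all $i\in\mathbb{Z}$, for some real coefficients $\alpha_i$. $\mathcal{W}\subset\mathcal{B}(\mathcal{H})^2$ denotes the set of all pairs $(L_0,L_1)$ of bounded, invertible weighted shift operators with positive coefficients (so each coefficient sequence is bounded and bounded away from zero). $\Sigma_2=\{0,1\}^{\mathbb{Z}}$ has the product topology and $\sigma[(x_i)_{i\in\mathbb{Z}}]=(x_{i+1})_{i\in\mathbb{Z}}$. $\mathcal{M}_\sigma$ is the set of $\sigma$-invariant Borel probability measures on $\Sigma_2$. For $(L_0,L_1)\in\mathcal{W}$, the joint spectral radius is $\varrho(L_0,L_1)=\lim_{n\to\infty}\sup_{x_1,\dots,x_n\in\{0,1\}}\|L_{x_n}\cdots L_{x_1}\|^{1/n}$. A measure $\mu\in\mathcal{M}_\sigma$ is a maximising measure of $(L_0,L_1)$ if $\lim_{n\to\infty}\frac1n\int\log\|L_{x_n}\cdots L_{x_1}\|\,d\mu(x)=\log\varrho(L_0,L_1)$. Logarithms (including in the entropy) are natural. *)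

(* Defs.v *)
From HB Require Import structures.
From mathcomp Require Import all_boot all_order all_algebra sesquilinear.
From mathcomp Require Import all_classical all_reals all_analysis.

Set Implicit Arguments.
Unset Strict Implicit.
Unset Printing Implicit Defensive.

Import Order.TTheory GRing.Theory Num.Theory.
Import numFieldNormedType.Exports.

Local Open Scope classical_set_scope.
Local Open Scope ring_scope.

Section Operators.
Context {R : realType} {H : completeNormedModType R}.

(* Together with completeness of [H] this says that [H], with inner product
   [ip], is a real Hilbert space; positive definiteness is part of [{dot _}]. *)
Definition norm_from_dot (ip : {dot H for idfun}) : Prop :=
  forall x : H, `|x| ^+ 2 = ip x x.

Definition lin_span (e : int -> H) : set H :=
  [set x | exists (s : seq int) (c : int -> R), x = \sum_(i <- s) c i *: e i].

(* Separability of [H] follows from the existence of such a family. *)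
Definition orthonormal_basis (ip : {dot H for idfun}) (e : int -> H) : Prop :=
  (forall i j : int, ip (e i) (e j) = (i == j)%:R) /\
  closure (lin_span e) = [set: H].

Definition bounded_operator (L : {linear H -> H}) : Prop :=
  exists M : R, forall x : H, `|L x| <= M * `|x|.

Definition invertible_operator (L : {linear H -> H}) : Prop :=
  exists K : {linear H -> H}, [/\ bounded_operator K, cancel L K & cancel K L].

Definition weighted_shift (e : int -> H) (alpha : int -> R)
    (L : {linear H -> H}) : Prop :=
  bounded_operator L /\ forall i : int, L (e i) = alpha i *: e (i + 1).

Definition positive_invertible_shift (e : int -> H) (L : {linear H -> H}) :=
  exists alpha : int -> R, [/\ weighted_shift e alpha L,
    forall i : int, 0 < alpha i & invertible_operator L].

Definition shift_pairs (e : int -> H) : set ({linear H -> H} * {linear H -> H}) :=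
  [set L | positive_invertible_shift e L.1 /\ positive_invertible_shift e L.2].

(* [sup] is meaningful here only when [f] is bounded on the unit ball. *)
Definition op_norm (f : H -> H) : R :=
  sup [set `|f x| | x in [set x : H | `|x| <= 1]].

Definition pick_op (L : {linear H -> H} * {linear H -> H}) (b : bool) :
  {linear H -> H} := if b then L.2 else L.1.

(* [word_op L [:: x1; ...; xn]] is the operator L_{xn} ... L_{x1}: the first
   letter acts first. *)
Definition word_op (L : {linear H -> H} * {linear H -> H}) (w : seq bool) :
  H -> H := fun v => foldl (fun u b => pick_op L b u) v w.

Definition joint_spectral_radius (L : {linear H -> H} * {linear H -> H}) : R :=
  limn (fun n : nat =>
    sup (range (fun w : n.-tuple bool => op_norm (word_op L w) `^ n%:R^-1))).

End Operators.

Definition cantor_Z : topologicalType := prod_topology (fun _ : int => bool).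

(* The sequence space {0,1}^Z with the Borel sigma-algebra of its product
   topology ([bool] being discrete). *)
Definition Sigma2 := g_sigma_algebraType (@open cantor_Z).

Definition sigma (x : Sigma2) : Sigma2 := fun i : int => x (i + 1).

Section Entropy.
Context {R : realType} {d : measure_display} {T : measurableType d}.

Definition invariant_measure (f : T -> T) (mu : probability T R) : Prop :=
  forall A : set T, measurable A -> pushforward mu f A = mu A.

(* Cells may be empty; empty cells contribute nothing to the entropy. *)
Definition finite_measurable_partition (k : nat) (A : 'I_k -> set T) : Prop :=
  [/\ forall i, measurable (A i), trivIset [set: 'I_k] A &
      \bigcup_i A i = [set: T]].

(* Since [ln 0 = 0], the convention 0 log 0 = 0 holds. *)
Definition partition_entropy (mu : probability T R) (I : finType)
    (A : I -> set T) : R :=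
  - \sum_(i : I) fine (mu (A i)) * ln (fine (mu (A i))).

(* The join of A, f^-1 A, ..., f^-(n-1) A, indexed by itineraries. *)
Definition iterated_join (f : T -> T) (k : nat) (A : 'I_k -> set T) (n : nat)
    (w : {ffun 'I_n -> 'I_k}) : set T :=
  \bigcap_(i : 'I_n) (iter i f @^-1` A (w i)).

Definition entropy_wrt_partition (mu : probability T R) (f : T -> T)
    (k : nat) (A : 'I_k -> set T) : R :=
  limn (fun n : nat =>
    n%:R^-1 * partition_entropy mu (@iterated_join f k A n)).

Definition metric_entropy (mu : probability T R) (f : T -> T) : \bar R :=
  ereal_sup [set z | exists (k : nat) (A : 'I_k -> set T),
    finite_measurable_partition A /\ z = (entropy_wrt_partition mu f A)%:E].

End Entropy.

Section Maximising.
Context {R : realType} {H : completeNormedModType R}.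

Definition first_letters (n : nat) (x : Sigma2) : seq bool :=
  mkseq (fun i : nat => x i.+1%:Z) n.

Definition maximising_measure (L : {linear H -> H} * {linear H -> H})
    (mu : probability Sigma2 R) : Prop :=
  invariant_measure sigma mu /\
  (n%:R^-1 * (\int[mu]_x ln (op_norm (word_op L (first_letters n x))))%R
     @[n --> \oo] --> ln (joint_spectral_radius L)).

End Maximising.

(* Main.v *)
(* Choose p in [0,1) so that the Bernoulli measure mu of weight p has entropy h,
   and a two-sided sequence z containing every finite word. The coefficient of
   L_b at e_i is exp(- F(z_i, z_{i+1}, ...) - [b <> z_i]) for a continuous
   potential F. Then log ||L_{x_n} ... L_{x_1}|| is minus the infimum, over the
   windows y of z, of the n-th Birkhoff sum of F at y plus the Hamming distance
   between x and y.

   F is a uniform limit of sums of local functions F_{k+1} - A F_k, where A is a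
   long ergodic average, F_0 = 0 and
     F_{k+1} = max(A F_k - 4^-k, 0) + 2^-k (A g_k)^2,
   g_k being the deviation of the frequency of a word w_k from its
   mu-probability, and every word being listed infinitely often. Up to
   coboundaries F agrees with each F_k to within O(2^-k), and by the weak law of
   large numbers the mean of F_k is at most 4^-k if A is long enough. So the
   Birkhoff sums of F are at least -o(n) everywhere and at most o(n) on
   mu-average: the joint spectral radius is 1 and mu is maximising. If an
   invariant measure gives some word a probability different from that under mu,
   then the square in F_{k+1}, bounded below by a linear function of g_k, forces
   a strictly negative growth rate; small slopes let the Hamming distance absorb
   the replacement of x by y.

   The entropy of mu is bounded above by comparing, in Gibbs' inequality, the
   itinerary of an arbitrary partition with a noisy function of finitely many
   coordinates. *)
Require Import Defs.
From HB Require Import structures.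
From mathcomp Require Import all_boot all_order all_algebra sesquilinear.
From mathcomp Require Import all_classical all_reals all_analysis.
From mathcomp Require Import measurable_realfun.
From mathcomp Require Import ring lra zify.

Import Order.TTheory GRing.Theory Num.Theory.
Import numFieldNormedType.Exports.

Local Open Scope classical_set_scope.
Local Open Scope ring_scope.

(** * Functions of one-sided binary sequences *)

(** A shift with positive coefficients has norm the supremum of these, so the universality of z
    turns norms into an optimisation over all binary sequences; the mismatch cost ties the letters x
    to the window y. Nonnegativity of [F_k] at every point bounds the growth from above and
    smallness of its mean bounds it from below: the truncation preserves the first, and the weak law
    restores the second with a smaller constant. The scales 4^-k and 2^-k differ on purpose. An
    increment is never below -4^-k, so all that is lost after step k is of order 4^-k, negligible
    against the penalty 2^-k put in at that step; since each word returns at arbitrarily late k, the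
    ratio 2^-k drops below any detection threshold. The deviation is squared because its mean is
    then a variance, of order 1/N. Bernoulli expectations are computed with the transfer operator on
    functions of finitely many letters; integrals appear only when the growth of norms is
    averaged. *)

Definition behead_stream (x : nat -> bool) : nat -> bool := fun k => x k.+1.

Definition cons_stream (b : bool) (x : nat -> bool) : nat -> bool :=
  fun k => if k is k'.+1 then x k' else b.

Lemma cons_behead (x : nat -> bool) : cons_stream (x 0%N) (behead_stream x) = x.
Proof. by apply/funext => -[]. Qed.

Lemma iter_beheadE j (x : nat -> bool) k :
  iter j behead_stream x k = x (j + k)%N.
Proof. by elim: j k => [//|j IH] k; rewrite iterS /behead_stream IH addnS. Qed.

Definition bernoulli_weight {R : realType} (p : R) (b : bool) : R :=
  if b then p else 1 - p.

Section StreamFunctions.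
Context {R : realType}.
Implicit Types (f g : (nat -> bool) -> R) (x y : nat -> bool).

Definition local_upto m f :=
  forall x y, (forall k, (k < m)%N -> x k = y k) -> f x = f y.

Lemma local_upto_le m n f : (m <= n)%N -> local_upto m f -> local_upto n f.
Proof.
by move=> mn fm x y xy; apply: fm => k km; apply: xy; exact: leq_trans km mn.
Qed.

Lemma local_upto_op2 (op : R -> R -> R) m f g :
  local_upto m f -> local_upto m g -> local_upto m (fun x => op (f x) (g x)).
Proof. by move=> fm gm x y xy; rewrite (fm x y xy) (gm x y xy). Qed.

Lemma local_upto_op1 (op : R -> R) m f :
  local_upto m f -> local_upto m (fun x => op (f x)).
Proof. by move=> fm x y xy; rewrite (fm x y xy). Qed.

Lemma local_upto_iter m j f :
  local_upto m f -> local_upto (j + m) (fun x => f (iter j behead_stream x)).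
Proof.
move=> fm x y xy; apply: fm => k km; rewrite !iter_beheadE.
by apply: xy; rewrite ltn_add2l.
Qed.

(** Fixing the first letter lowers the number of letters read by one; the bounds for the two choices
    are added. *)
Lemma local_upto_bounded m f : local_upto m f ->
  exists2 B, 0 <= B & forall x, `|f x| <= B.
Proof.
elim: m f => [|m IH] f fm.
  by exists `|f (fun=> false)| => // x; rewrite (fm x (fun=> false)).
have fb b : local_upto m (fun x => f (cons_stream b x)).
  by move=> x y xy; apply: fm => -[//|k] km; exact: xy.
have [B0 B0ge0 hB0] := IH _ (fb false); have [B1 B1ge0 hB1] := IH _ (fb true).
exists (B0 + B1); first exact: addr_ge0.
move=> x; rewrite -(cons_behead x); case: (x 0%N).
  by apply: le_trans (hB1 _) _; rewrite lerDr.
by apply: le_trans (hB0 _) _; rewrite lerDl.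
Qed.

Definition birkhoff n f x : R := \sum_(j < n) f (iter j behead_stream x).

Lemma birkhoffS n f x : birkhoff n.+1 f x = f x + birkhoff n f (behead_stream x).
Proof.
rewrite /birkhoff big_ord_recl /=; congr (_ + _).
by apply: eq_bigr => j _; rewrite -iterS iterSr.
Qed.

Lemma birkhoffSr n f x :
  birkhoff n.+1 f x = birkhoff n f x + f (iter n behead_stream x).
Proof. by rewrite /birkhoff big_ord_recr. Qed.

Lemma local_upto_birkhoff m n f :
  local_upto m f -> local_upto (n + m) (birkhoff n f).
Proof.
move=> fm x y xy; apply: eq_bigr => j _; apply: fm => k km.
by rewrite !iter_beheadE; apply: xy; have := ltn_ord j; lia.
Qed.

Lemma le_birkhoff n f g x :
  (forall y, f y <= g y) -> birkhoff n f x <= birkhoff n g x.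
Proof. by move=> fg; apply: ler_sum => j _. Qed.

Lemma birkhoff_lin n a f g x :
  birkhoff n (fun y => a * f y + g y) x = a * birkhoff n f x + birkhoff n g x.
Proof. by rewrite /birkhoff big_split /= mulr_sumr. Qed.

Lemma birkhoff_cst n (c : R) x : birkhoff n (fun=> c) x = n%:R * c.
Proof. by rewrite /birkhoff sumr_const card_ord mulr_natl. Qed.

(** Each step along the orbit exchanges one term of the sum for another, at a cost of [2 * B]
    whatever [n] is. *)
Lemma birkhoff_iter n j f x B : (forall y, `|f y| <= B) ->
  `|birkhoff n f (iter j behead_stream x) - birkhoff n f x| <= j%:R * (2 * B).
Proof.
move=> fB; elim: j => [|j IH]; first by rewrite subrr normr0 mul0r.
set y := iter j behead_stream x in IH *; rewrite iterS -/y.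
have -> : birkhoff n f (behead_stream y) - birkhoff n f x =
    (f (iter n behead_stream y) - f y) + (birkhoff n f y - birkhoff n f x).
  have := birkhoffS n f y; rewrite birkhoffSr => E.
  have -> : birkhoff n f (behead_stream y) =
    birkhoff n f y + f (iter n behead_stream y) - f y by rewrite E; ring.
  ring.
rewrite -natr1 mulrDl mul1r.
apply: le_trans (ler_normD _ _) _.
rewrite [leRHS]addrC; apply: lerD IH.
by apply: le_trans (ler_normB _ _) _; rewrite mulr_natl mulr2n lerD.
Qed.

Definition ergodic_avg N f x : R := N%:R^-1 * birkhoff N f x.

Lemma local_upto_ergodic_avg m N f :
  local_upto m f -> local_upto (N + m) (ergodic_avg N f).
Proof. by move=> fm; apply: local_upto_op1; exact: local_upto_birkhoff. Qed.

Lemma ergodic_avg_ge0 N f x : (forall y, 0 <= f y) -> 0 <= ergodic_avg N f x.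
Proof. by move=> f0; rewrite mulr_ge0// ?invr_ge0// sumr_ge0. Qed.

(** The Birkhoff sum of the average is the mean of [N] shifted Birkhoff sums of [f]. The bound does
    not involve [n], so averaging is free at the scale of growth rates. *)
Lemma birkhoff_ergodic_avg N n f x B : (0 < N)%N -> 0 <= B ->
  (forall y, `|f y| <= B) ->
  `|birkhoff n (ergodic_avg N f) x - birkhoff n f x| <= N%:R * (2 * B).
Proof.
move=> N0 B0 fB; have N0' : 0 < N%:R :> R by rewrite ltr0n.
have -> : birkhoff n (ergodic_avg N f) x =
    N%:R^-1 * \sum_(j < N) birkhoff n f (iter j behead_stream x).
  rewrite /birkhoff /ergodic_avg -mulr_sumr exchange_big /=; congr (_ * _).
  apply: eq_bigr => i _; apply: eq_bigr => j _.
  by rewrite -!iterD addnC.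
have -> : birkhoff n f x = N%:R^-1 * \sum_(j < N) birkhoff n f x.
  by rewrite sumr_const card_ord -[X in _ * X]mulr_natl mulKf ?lt0r_neq0.
rewrite -mulrBr -sumrB normrM ger0_norm ?invr_ge0 ?ler0n//.
rewrite ler_pdivrMl//.
apply: le_trans (ler_norm_sum _ _ _) _.
apply: (@le_trans _ _ (\sum_(j < N) N%:R * (2 * B))); last first.
  by rewrite sumr_const card_ord [leRHS]mulr_natl.
apply: ler_sum => j _; apply: le_trans (birkhoff_iter _ _ _ _ _ fB) _.
by rewrite ler_wpM2r ?mulr_ge0// ler_nat ltnW.
Qed.

(** * The transfer operator of the Bernoulli measure *)

Section Transfer.
Variable p : R.
Hypotheses (p_ge0 : 0 <= p) (p_le1 : p <= 1).

(** Conditional expectation given all letters but the first, read as a function of the shifted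
    sequence. Its iterates integrate out the letters one by one. *)
Definition transfer f x : R :=
  p * f (cons_stream true x) + (1 - p) * f (cons_stream false x).

Local Notation P n := (iter n transfer).

Lemma transfer_iter_le n f g x :
  (forall y, f y <= g y) -> P n f x <= P n g x.
Proof.
elim: n f g x => [|n IH] f g x fg; first exact: fg.
rewrite !iterSr; apply: IH => y; rewrite /transfer.
by apply: lerD; apply: ler_wpM2l; rewrite ?subr_ge0.
Qed.

Lemma transfer_iter_lin n a f g x :
  P n (fun y => a * f y + g y) x = a * P n f x + P n g x.
Proof.
elim: n x => [//|n IH] x; rewrite !iterS /transfer !IH /=.
by ring.
Qed.

Lemma transfer_iter_cst n (c : R) x : P n (fun=> c) x = c.
Proof.
elim: n x => [//|n IH] x; rewrite !iterS /transfer !IH; ring.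
Qed.

Lemma transfer_iter_scale n a f x : P n (fun y => a * f y) x = a * P n f x.
Proof.
have := transfer_iter_lin n a f (fun=> 0) x; rewrite transfer_iter_cst addr0.
by move=> <-; congr (P n _ x); apply/funext => y; rewrite addr0.
Qed.

Lemma transfer_iter_sum n (I : Type) (r : seq I) (F : I -> (nat -> bool) -> R) x :
  P n (fun y => \sum_(i <- r) F i y) x = \sum_(i <- r) P n (F i) x.
Proof.
elim: r => [|i r IH].
  rewrite big_nil -[RHS](transfer_iter_cst n 0 x); congr (P n _ x).
  by apply/funext => y; rewrite big_nil.
rewrite big_cons -IH -[X in X + _]mul1r -transfer_iter_lin; congr (P n _ x).
by apply/funext => y; rewrite big_cons mul1r.
Qed.

(** The pull-out rule of conditional expectations: a factor that ignores the first [n] letters is a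
    constant for the averaging over them. *)
Lemma transfer_iter_mul n f g x :
  P n (fun y => f y * g (iter n behead_stream y)) x = P n f x * g x.
Proof.
elim: n f x => [//|n IH] f x; rewrite !iterSr.
rewrite -IH; congr (P n _ x); apply/funext => y; rewrite /transfer.
by rewrite !iterSr; rewrite /behead_stream /=; ring.
Qed.

Lemma transfer_iter_behead n j g x : (j <= n)%N ->
  P n (fun y => g (iter j behead_stream y)) x = P (n - j) g x.
Proof.
move=> jn; rewrite -{1}(subnK jn) iterD; congr (iter _ _ _ x).
apply/funext => y; have := transfer_iter_mul j (fun=> 1) g y.
rewrite transfer_iter_cst mul1r => <-; congr (iter j _ _ y).
by apply/funext => z; rewrite mul1r.
Qed.

Lemma transfer_iter_local m n f x y : local_upto m f -> (m <= n)%N ->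
  P n f x = P m f y.
Proof.
move=> fm mn; have Pm0 : local_upto 0 (P m f).
  elim: m f fm {mn} => [//|m IH] f fm; rewrite iterSr; apply: IH => u v uv.
  by rewrite /transfer; congr (_ * _ + _ * _); apply: fm => -[//|k] km; exact: uv.
rewrite -(subnK mn) iterD.
rewrite (_ : P m f = fun=> P m f y); first exact: transfer_iter_cst.
by apply/funext => z; exact: Pm0.
Qed.

(** The expectation of a local function, read off as the value at which its transfer iterates become
    constant; no measure is involved. *)
Definition has_mean f (c : R) :=
  exists M, forall n x, (M <= n)%N -> P n f x = c.

Lemma local_has_mean m f : local_upto m f -> exists c, has_mean f c.
Proof.
move=> fm; exists (P m f (fun=> false)), m => n x mn.
exact: transfer_iter_local.
Qed.

Lemma has_mean_lin a f g c d : has_mean f c -> has_mean g d ->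
  has_mean (fun x => a * f x + g x) (a * c + d).
Proof.
move=> [M fM] [M' gM]; exists (maxn M M') => n x; rewrite geq_max => /andP[Mn M'n].
by rewrite transfer_iter_lin fM// gM.
Qed.

Lemma has_mean_cst (c : R) : has_mean (fun=> c) c.
Proof. by exists 0%N => n x _; exact: transfer_iter_cst. Qed.

Lemma has_mean_le f g c d : (forall x, f x <= g x) ->
  has_mean f c -> has_mean g d -> c <= d.
Proof.
move=> fg [M fM] [M' gM]; pose n := maxn M M'; pose o : nat -> bool := fun=> false.
rewrite -(fM n o) ?leq_maxl// -(gM n o) ?leq_maxr//.
exact: transfer_iter_le.
Qed.

Lemma has_mean_ergodic_avg N f c : (0 < N)%N ->
  has_mean f c -> has_mean (ergodic_avg N f) c.
Proof.
move=> N0 [M fM]; exists (N + M)%N => n x Mn.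
rewrite /ergodic_avg transfer_iter_scale /birkhoff transfer_iter_sum.
rewrite (eq_bigr (fun=> c)) => [|j _].
  by rewrite sumr_const card_ord -[X in _ * X]mulr_natl mulKf// pnatr_eq0 -lt0n.
have jN := ltn_ord j.
rewrite transfer_iter_behead; last by apply: leq_trans Mn; lia.
by rewrite fM//; lia.
Qed.

(** Variance bound for sums of [m]-dependent centred variables. Peeling off the first term leaves
    its square and its correlations with later terms, and those at a lag beyond [m] vanish. *)
Lemma transfer_birkhoff_sqr m f B N n x : local_upto m f -> has_mean f 0 ->
  0 <= B -> (forall y, `|f y| <= B) -> (N + m <= n)%N ->
  P n (fun y => birkhoff N f y ^+ 2) x <= N%:R * ((2 * m + 1)%:R * B ^+ 2).
Proof.
move=> fm [M f0] B0 fB.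
have {M}f0 y : P m f y = 0.
  by rewrite -(transfer_iter_local _ _ _ y y fm (leq_maxr M m)) f0// leq_maxl.
elim: N n x => [|N IH] [|n] x mn.
- by rewrite /birkhoff /= big_ord0 mul0r expr0n.
- rewrite mul0r (_ : (fun _ => _) = fun=> 0) ?transfer_iter_cst//.
  by apply/funext => y; rewrite /birkhoff big_ord0 expr0n.
- by move: mn; rewrite addSn ltn0.
pose q y := 2 * (\sum_(j < N) f y * f (iter j.+1 behead_stream y)) + f y ^+ 2.
have -> : (fun y => birkhoff N.+1 f y ^+ 2) =
    fun y => 1 * (birkhoff N f (iter 1 behead_stream y) ^+ 2) + q y.
  apply/funext => y; rewrite birkhoffS /q -mulr_sumr mul1r /=.
  rewrite (_ : \sum_(i < N) _ = birkhoff N f (behead_stream y)); first by ring.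
  by apply: eq_bigr => j _; rewrite -iterS iterSr.
rewrite transfer_iter_lin mul1r.
rewrite (transfer_iter_behead n.+1 1 (fun y => birkhoff N f y ^+ 2))// subSS subn0.
rewrite -natr1 mulrDl mul1r; apply: lerD; first by apply: IH; lia.
rewrite /q transfer_iter_lin transfer_iter_sum.
have -> : (2 * m + 1)%:R * B ^+ 2 = 2 * (m%:R * B ^+ 2) + B ^+ 2.
  by rewrite natrD natrM; ring.
apply: lerD; last first.
  rewrite -[leRHS](transfer_iter_cst n.+1 (B ^+ 2) x).
  by apply: transfer_iter_le => y; rewrite -real_normK ?num_real// lerXn2r ?nnegrE.
rewrite ler_wpM2l//.
apply: (@le_trans _ _ (\sum_(j < N) if (j < m)%N then B ^+ 2 else 0)); last first.
  rewrite -big_mkcond sumr_const -[leLHS]mulr_natl ler_wpM2r ?sqr_ge0//.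
  rewrite ler_nat -[leqRHS](card_ord m).
  case: (leqP m N) => mN; last first.
    by apply: leq_trans (max_card _) _; rewrite !card_ord ltnW.
  rewrite -[leqRHS](card_codom (f := widen_ord mN)); last first.
    by move=> u v /(congr1 val) /= uv; exact: val_inj.
  apply: subset_leq_card; apply/fintype.subsetP => u um.
  by apply/codomP; exists (Ordinal um); apply: val_inj.
apply: ler_sum => j _; case: ifPn => jm.
  rewrite -[leRHS](transfer_iter_cst n.+1 (B ^+ 2) x).
  apply: transfer_iter_le => y.
  apply: le_trans (ler_norm _) _; rewrite normrM expr2.
  by apply: ler_pM.
(* The lag now exceeds [m]: [j.+1] iterations integrate [f] out completely, and its zero mean kills
   the correlation. *)
have jn : (j.+1 <= n.+1)%N by have := ltn_ord j; lia.
rewrite -(subnK jn) iterD.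
rewrite (_ : P j.+1 _ = fun=> 0) ?transfer_iter_cst//.
apply/funext => y; rewrite transfer_iter_mul.
by rewrite (transfer_iter_local m j.+1 f y y fm) ?f0 ?mul0r//; lia.
Qed.

End Transfer.
End StreamFunctions.

(** * A potential minimised only by the Bernoulli measure *)

Section Potential.
Context {R : realType}.
Variable p : R.
Hypotheses (p_ge0 : 0 <= p) (p_le1 : p <= 1).
Implicit Types (f g : (nat -> bool) -> R) (x y : nat -> bool).

Definition mean_eventually_le f (c : R) :=
  exists M, forall n x, (M <= n)%N -> iter n (transfer p) f x <= c.

Lemma has_mean_eventually_le f c e : mean_eventually_le f c ->
  has_mean p f e -> e <= c.
Proof.
move=> [M fM] [M' fM']; pose n := maxn M M'; pose o : nat -> bool := fun=> false.
by rewrite -(fM' n o) ?leq_maxr// fM// leq_maxl.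
Qed.

(** Chebyshev's argument: the positive part is dominated by a square plus [eta], and both squares
    have mean of order [1 / N]. *)
Lemma weak_law mf mg f g c e b eps :
  local_upto mf f -> has_mean p f e -> e <= c ->
  local_upto mg g -> has_mean p g 0 -> 0 <= b -> 0 < eps ->
  exists2 N, (0 < N)%N & mean_eventually_le (fun x =>
    Num.max (ergodic_avg N f x - c) 0 + b * ergodic_avg N g x ^+ 2) eps.
Proof.
move=> fm fe ec gm g0 b0 eps0.
pose f0 x := 1 * f x + (- e).
have f0m : local_upto mf f0 by apply: (local_upto_op1 (fun t => 1 * t + (- e))).
have f0e : has_mean p f0 0.
  rewrite -(subrr e) -{1}[e]mul1r.
  by apply: has_mean_lin => //; exact: has_mean_cst.
have [B1 B1_ge0 hB1] := local_upto_bounded _ _ f0m.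
have [B2 B2_ge0 hB2] := local_upto_bounded _ _ gm.
pose eta := eps / 2; have eta0 : 0 < eta by rewrite divr_gt0.
pose C1 := (2 * mf + 1)%:R * B1 ^+ 2; pose C2 := (2 * mg + 1)%:R * B2 ^+ 2.
pose D := (4 * eta)^-1 * C1 + b * C2.
have [N ND] : exists N, D / eta < N%:R.
  by exists (Num.truncn (D / eta)).+1; exact: truncnS_gt.
have C1_ge0 : 0 <= C1 by rewrite mulr_ge0// sqr_ge0.
have C2_ge0 : 0 <= C2 by rewrite mulr_ge0// sqr_ge0.
have D_ge0 : 0 <= D.
  by rewrite addr_ge0// mulr_ge0// invr_ge0 mulr_ge0// ltW.
have NR_gt0 : 0 < N%:R :> R.
  by apply: le_lt_trans ND; rewrite divr_ge0// ltW.
have N_gt0 : (0 < N)%N by rewrite ltr0n in NR_gt0.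
exists N => //; exists (N + maxn mf mg)%N => n x Nn.
pose s1 y := birkhoff N f0 y ^+ 2; pose s2 y := birkhoff N g y ^+ 2.
have le1 : iter n (transfer p) s1 x <= N%:R * C1.
  by apply: transfer_birkhoff_sqr => //; apply: leq_trans Nn; rewrite leq_add2l leq_maxl.
have le2 : iter n (transfer p) s2 x <= N%:R * C2.
  by apply: transfer_birkhoff_sqr => //; apply: leq_trans Nn; rewrite leq_add2l leq_maxr.
(* Uses [t <= t ^+ 2 / (4 * eta) + eta], which is [(t - 2 * eta) ^+ 2 >= 0], for the centred average
   [t]; since [e <= c], [t] is at least the average minus [c]. *)
have key y : Num.max (ergodic_avg N f y - c) 0 + b * ergodic_avg N g y ^+ 2 <=
    ((4 * eta)^-1 * N%:R^-1 ^+ 2) * s1 y + ((b * N%:R^-1 ^+ 2) * s2 y + eta).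
  rewrite /s1 /s2 /ergodic_avg exprMn.
  suff : Num.max (N%:R^-1 * birkhoff N f y - c) 0 <=
      (4 * eta)^-1 * (N%:R^-1 * birkhoff N f0 y) ^+ 2 + eta by rewrite exprMn; lra.
  set t := N%:R^-1 * birkhoff N f0 y.
  have -> : N%:R^-1 * birkhoff N f y = t + e.
    rewrite /t /f0 birkhoff_lin birkhoff_cst; field.
    by rewrite lt0r_neq0.
  rewrite ge_max; apply/andP; split; last first.
    by apply: addr_ge0; [rewrite mulr_ge0 ?sqr_ge0 ?invr_ge0 ?mulr_ge0// ltW | exact: ltW].
  apply: (@le_trans _ _ t); first lra.
  rewrite -subr_ge0 (_ : _ - t = (4 * eta)^-1 * (t - 2 * eta) ^+ 2).
    by rewrite mulr_ge0// ?sqr_ge0// invr_ge0 mulr_ge0// ltW.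
  by field; rewrite lt0r_neq0.
apply: (le_trans (transfer_iter_le p p_ge0 p_le1 n _ _ x key)).
rewrite !transfer_iter_lin transfer_iter_cst.
have N2 : 0 <= N%:R^-1 ^+ 2 :> R by rewrite sqr_ge0.
apply: (@le_trans _ _ (((4 * eta)^-1 * N%:R^-1 ^+ 2) * (N%:R * C1) +
   ((b * N%:R^-1 ^+ 2) * (N%:R * C2) + eta))).
  apply: lerD; first by rewrite ler_wpM2l// mulr_ge0// invr_ge0 mulr_ge0// ltW.
  by apply: lerD => //; rewrite ler_wpM2l// mulr_ge0.
have -> : (4 * eta)^-1 * N%:R^-1 ^+ 2 * (N%:R * C1) +
   (b * N%:R^-1 ^+ 2 * (N%:R * C2) + eta) = D / N%:R + eta.
  by rewrite /D; field; rewrite !lt0r_neq0.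
have : D / N%:R <= eta.
  by rewrite ler_pdivrMr// mulrC -ler_pdivrMr// ltW.
by rewrite /eta; lra.
Qed.

Definition word_weight (w : seq bool) : R := \prod_(b <- w) bernoulli_weight p b.

Definition word_dev (w : seq bool) x : R :=
  (mkseq x (size w) == w)%:R - word_weight w.

Lemma mkseq_behead x n : mkseq x n.+1 = x 0%N :: mkseq (behead_stream x) n.
Proof. by rewrite /mkseq /= -[1%N]/(1 + 0)%N iotaDl -map_comp. Qed.

Lemma local_upto_mkseq (F : seq bool -> R) n :
  local_upto n (fun x => F (mkseq x n)).
Proof.
move=> x y xy; congr F; apply/eq_in_map => k.
by rewrite mem_iota add0n; exact: xy.
Qed.

Lemma local_word_dev w : local_upto (size w) (word_dev w).
Proof. exact: (local_upto_mkseq (fun u => (u == w)%:R - word_weight w)). Qed.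

Lemma bernoulli_weight_ge0 b : 0 <= bernoulli_weight p b.
Proof. by case: b; rewrite /= ?subr_ge0. Qed.

Lemma word_weight_ge0 w : 0 <= word_weight w.
Proof. by apply: prodr_ge0 => b _; exact: bernoulli_weight_ge0. Qed.

Lemma word_weight_le1 w : word_weight w <= 1.
Proof.
rewrite /word_weight; elim: w => [|b w IH]; first by rewrite big_nil.
rewrite big_cons mulr_ile1 ?bernoulli_weight_ge0//; first exact: word_weight_ge0.
by case: b => //=; rewrite gerBl.
Qed.

Lemma word_dev_le1 w x : `|word_dev w x| <= 1.
Proof.
have := word_weight_ge0 w; have := word_weight_le1 w; rewrite /word_dev ler_norml.
by case: eqP => _ /=; rewrite ?mulr1n ?mulr0n; lra.
Qed.

Lemma has_mean_word_dev w : has_mean p (word_dev w) 0.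
Proof.
rewrite -(subrr (word_weight w)) -{1}[word_weight w]mul1r.
suff hw : has_mean p (fun x => (mkseq x (size w) == w)%:R : R) (word_weight w).
  rewrite (_ : word_dev w = fun x =>
    1 * (mkseq x (size w) == w)%:R + (- word_weight w)).
    by apply: has_mean_lin => //; exact: has_mean_cst.
  by apply/funext => x; rewrite mul1r.
exists (size w) => n x wn.
rewrite (transfer_iter_local _ (size w) _ _ x x)//; last first.
  exact: (local_upto_mkseq (fun v => (v == w)%:R)).
elim: w {n wn} x => [|b w IH] x; first by rewrite /= /word_weight big_nil.
rewrite /= -iterS iterSr /word_weight big_cons -/(word_weight w) -(IH x).
rewrite -transfer_iter_scale; congr (iter _ _ _ x); apply/funext => y.
rewrite /transfer !mkseq_behead /=.
rewrite !eqseq_cons; case: b => /=; rewrite ?mulr0 ?addr0 ?add0r//.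
Qed.

(* Pairing with an unused integer makes every word occur infinitely often. *)
Definition target_word (k : nat) : seq bool :=
  if @unpickle (nat * seq bool)%type k is Some u then u.2 else [::].

(** Infinitely many indices encode [w], one for each integer paired with it; by the pigeonhole
    principle they cannot all lie below [K]. *)
Lemma target_word_unbounded w K : exists2 k, (K <= k)%N & target_word k = w.
Proof.
have inj : injective (fun j : nat => pickle (j, w)).
  by move=> i j /(pcan_inj pickleK)[].
suff [j jK] : exists j : nat, (K <= pickle (j, w))%N.
  by exists (pickle (j, w)) => //; rewrite /target_word pickleK.
apply: contrapT => /forallNP hj.
have hlt (j : nat) : (pickle (j, w) < K)%N by rewrite ltnNge; apply/negP; exact: hj.
pose F (j : 'I_K.+1) : 'I_K := Ordinal (hlt j).
have : injective F by move=> i j /(congr1 val) /= /inj /val_inj.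
by move/leq_card; rewrite !card_ord ltnn.
Qed.

Definition penalised k N f x :=
  Num.max (ergodic_avg N f x - 4^-1 ^+ k) 0 +
  2^-1 ^+ k * ergodic_avg N (word_dev (target_word k)) x ^+ 2.

(** [xget] lets [level] be a plain recursion; that a suitable [N] exists is shown afterwards, in
    [level_spec]. The default [1] makes the length positive without that proof. *)
Definition averaging_length k f : nat :=
  xget 1%N [set N | (0 < N)%N /\
    mean_eventually_le (penalised k N f) (4^-1 ^+ k.+1)].

Fixpoint level (k : nat) : (nat -> bool) -> R :=
  if k is k'.+1 then penalised k' (averaging_length k' (level k')) (level k')
  else fun=> 0.

(** The properties go through one induction, because the weak law at step [k] needs the locality and
    the mean bound of the level already built. *)
Lemma level_spec k : [/\ exists m, local_upto m (level k),
  forall x, 0 <= level k x & mean_eventually_le (level k) (4^-1 ^+ k)].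
Proof.
elim: k => [|k [[m lm] l0 lmean]].
  split=> //; first by exists 0%N.
  by exists 0%N => n x _; rewrite transfer_iter_cst expr0.
have [e le] := local_has_mean p _ _ lm.
have ec := has_mean_eventually_le _ _ _ lmean le.
have [] : [set N | (0 < N)%N /\
    mean_eventually_le (penalised k N (level k)) (4^-1 ^+ k.+1)]
    (averaging_length k (level k)).
  apply: xgetPex; have [||N N0 hN] := weak_law m _ (level k) _ _ e (2^-1 ^+ k)
    (4^-1 ^+ k.+1) lm le ec (local_word_dev (target_word k)) (has_mean_word_dev _).
  - by rewrite exprn_ge0.
  - by rewrite exprn_gt0.
  by exists N.
rewrite -[penalised _ _ _]/(level k.+1); set N := averaging_length _ _ => N0 hN.
split=> //.
- pose M := (N + maxn m (size (target_word k)))%N; exists M.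
  rewrite /level -/level -/N /penalised; apply: (local_upto_op2 +%R).
    apply: (local_upto_op1 (fun t => Num.max (t - _) 0)).
    apply: (local_upto_le (N + m)); first by rewrite leq_add2l leq_maxl.
    exact: local_upto_ergodic_avg.
  apply: (local_upto_op1 (fun t => _ * t ^+ 2)).
  apply: (local_upto_le (N + size (target_word k))).
    by rewrite leq_add2l leq_maxr.
  exact/local_upto_ergodic_avg/local_word_dev.
- move=> x; rewrite /= /penalised addr_ge0//; first by rewrite le_max lexx orbT.
  by apply: mulr_ge0; [rewrite exprn_ge0 | exact: sqr_ge0].
Qed.

Lemma averaging_length_gt0 k : (0 < averaging_length k (level k))%N.
Proof.
by rewrite /averaging_length; case: xgetP => // N _ [].
Qed.

Definition increment k x :=
  level k.+1 x - ergodic_avg (averaging_length k (level k)) (level k) x.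

Lemma ergodic_avg_word_dev_sqr N w x : (0 < N)%N ->
  ergodic_avg N (word_dev w) x ^+ 2 <= 1.
Proof.
move=> N0; rewrite -real_normK ?num_real// expr_le1// normrM ger0_norm ?invr_ge0//.
rewrite ler_pdivrMl ?ltr0n// mulr1; apply: le_trans (ler_norm_sum _ _ _) _.
rewrite -[leRHS]mulr1 mulr_natl -[in leRHS](card_ord N) -sumr_const.
by apply: ler_sum => j _; exact: word_dev_le1.
Qed.

(** For the average [s >= 0] of the level, [max(s - 4^-k, 0) - s] lies between [- 4^-k] and [0], and
    the quadratic penalty lies between [0] and [2^-k]. *)
Lemma increment_bounds k x :
  - 4^-1 ^+ k <= increment k x <= 2^-1 ^+ k.
Proof.
have [_ l0 _] := level_spec k; rewrite /increment /= /penalised.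
set N := averaging_length _ _.
have A0 : 0 <= ergodic_avg N (level k) x by exact: ergodic_avg_ge0.
have g0 : 0 <= ergodic_avg N (word_dev (target_word k)) x ^+ 2 by exact: sqr_ge0.
have g1 := ergodic_avg_word_dev_sqr N (target_word k) x (averaging_length_gt0 k).
have h2 : 0 <= 2^-1 ^+ k :> R by rewrite exprn_ge0.
have h4 : 0 <= 4^-1 ^+ k :> R by rewrite exprn_ge0.
have := mulr_ge0 h2 g0.
have : 2^-1 ^+ k * ergodic_avg N (word_dev (target_word k)) x ^+ 2 <= 2^-1 ^+ k.
  by rewrite ler_piMr.
set u : R := 2^-1 ^+ k in h2 *; set v : R := 4^-1 ^+ k in h4 *.
set t := u * _; set s := ergodic_avg N (level k) x in A0 *.
by case: (leP (s - v) 0) => *; apply/andP; split; lra.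
Qed.

Definition partial_potential K x := \sum_(k < K) increment k x.

(** As [level 0] vanishes, [partial_potential K] regroups into [level K] plus the differences
    between each earlier level and its average, whose Birkhoff sums are bounded in [n]. *)
Lemma partial_potential_birkhoff K : exists C, forall n x,
  `|birkhoff n (partial_potential K) x - birkhoff n (level K) x| <= C.
Proof.
elim: K => [|K [C hC]].
  exists 0 => n x; rewrite (_ : partial_potential 0 = level 0) ?subrr ?normr0//.
  by apply/funext => y; rewrite /partial_potential big_ord0.
have [[m lm] _ _] := level_spec K.
have [B B0 hB] := local_upto_bounded _ _ lm.
set N := averaging_length K (level K).
exists (C + N%:R * (2 * B)) => n x.
have -> : partial_potential K.+1 = fun y => 1 * partial_potential K y +
    (1 * level K.+1 y + (-1) * ergodic_avg N (level K) y).
  by apply/funext => y; rewrite /partial_potential big_ord_recr /= !mul1r mulN1r.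
rewrite !birkhoff_lin.
have -> : birkhoff n (fun y => -1 * ergodic_avg N (level K) y) x =
  - birkhoff n (ergodic_avg N (level K)) x.
  by rewrite /birkhoff -mulr_sumr mulN1r.
have h1 := hC n x.
have h2 := birkhoff_ergodic_avg N n (level K) x B (averaging_length_gt0 K) B0 hB.
rewrite !mul1r addrA.
have -> : birkhoff n (partial_potential K) x + birkhoff n (level K.+1) x -
  birkhoff n (ergodic_avg N (level K)) x - birkhoff n (level K.+1) x =
  (birkhoff n (partial_potential K) x - birkhoff n (level K) x) -
  (birkhoff n (ergodic_avg N (level K)) x - birkhoff n (level K) x) by ring.
by apply: le_trans (ler_normB _ _) _; exact: lerD.
Qed.

Lemma partial_potential_local K : exists m, local_upto m (partial_potential K).
Proof.
elim: K => [|K [m hm]].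
  by exists 0%N => x y xy; rewrite /partial_potential !big_ord0.
have [[m1 l1] _ _] := level_spec K; have [[m2 l2] _ _] := level_spec K.+1.
set N := averaging_length K (level K).
exists (maxn m (maxn m2 (N + m1))) => x y xy.
rewrite /partial_potential !big_ord_recr; congr (_ + (_ - _)).
- by apply: (local_upto_le _ _ _ _ hm _ _ xy); exact: leq_maxl.
- apply: (local_upto_le _ _ _ _ l2 _ _ xy); lia.
- apply: (local_upto_le _ _ _ _ (local_upto_ergodic_avg _ N _ l1) _ _ xy); lia.
Qed.

(** Averaging does not change the mean, so the means telescope exactly: [partial_potential K] and
    [level K] share [c]. *)
Lemma partial_potential_mean K :
  exists2 c, has_mean p (partial_potential K) c & c <= 4^-1 ^+ K.
Proof.
suff [c hc hl] : exists2 c, has_mean p (partial_potential K) c & has_mean p (level K) c.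
  exists c => //; have [_ _ lK] := level_spec K.
  exact: has_mean_eventually_le lK hl.
elim: K => [|K [c hc hl]].
  exists 0; last exact: has_mean_cst.
  rewrite (_ : partial_potential 0 = fun=> 0); first exact: has_mean_cst.
  by apply/funext => y; rewrite /partial_potential big_ord0.
have [[m2 l2] _ _] := level_spec K.+1.
have [d hd] := local_has_mean p _ _ l2.
exists d => //.
set N := averaging_length K (level K).
have hA := has_mean_ergodic_avg p p_ge0 p_le1 N _ _ (averaging_length_gt0 K) hl.
rewrite (_ : partial_potential K.+1 = fun x => 1 * partial_potential K x +
  ((-1) * ergodic_avg N (level K) x + level K.+1 x)).
  rewrite (_ : d = 1 * c + (-1 * c + d)); last by ring.
  by do 2 apply: has_mean_lin => //.
apply/funext => y; rewrite /partial_potential big_ord_recr /= /increment mul1r.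
by rewrite mulN1r [X in _ + X]addrC.
Qed.

Lemma sum_increment_bounds K J x :
  - (2 * 4^-1 ^+ K) <= \sum_(K <= k < K + J) increment k x <= 2 * 2^-1 ^+ K.
Proof.
(* The tails still to come are kept in the bounds, which makes them inductive in [J]. *)
suff : - (2 * 4^-1 ^+ K) + 2 * 4^-1 ^+ (K + J) <=
    \sum_(K <= k < K + J) increment k x <= 2 * 2^-1 ^+ K - 2 * 2^-1 ^+ (K + J).
  have : 0 <= 4^-1 ^+ (K + J) :> R by rewrite exprn_ge0.
  have : 0 <= 2^-1 ^+ (K + J) :> R by rewrite exprn_ge0.
  lra.
elim: J => [|J IH]; first by rewrite addn0 big_geq//; lra.
rewrite addnS big_nat_recr ?leq_addr//= !exprSr.
have := increment_bounds (K + J) x.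
have : 0 <= 4^-1 ^+ (K + J) :> R by rewrite exprn_ge0.
have : 0 <= 2^-1 ^+ (K + J) :> R by rewrite exprn_ge0.
by lra.
Qed.

Lemma partial_potentialB K J x : partial_potential (K + J) x =
  partial_potential K x + \sum_(K <= k < K + J) increment k x.
Proof.
rewrite /partial_potential -!(big_mkord xpredT (fun k => increment k x)).
by rewrite (big_cat_nat (n := K)) ?leq_addr.
Qed.

Definition potential x : R := limn (fun K => partial_potential K x).

Lemma potential_bounds K x :
  partial_potential K x - 2 * 4^-1 ^+ K <= potential x <=
  partial_potential K x + 2 * 2^-1 ^+ K.
Proof.
have cv : cvgn (fun K => partial_potential K x).
  rewrite (_ : (fun K => _) = series (fun k => increment k x)); last first.
    by apply/funext => n; rewrite /series /= big_mkord.
  apply: normed_cvg; apply: (@series_le_cvg _ _ (geometric 1 2^-1)).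
  - by move=> n /=.
  - by move=> n /=; rewrite mul1r exprn_ge0.
  - move=> n /=; rewrite mul1r.
    have := increment_bounds n x.
    have : (4^-1 : R) ^+ n <= 2^-1 ^+ n by rewrite lerXn2r ?nnegrE// lef_pV2 ?posrE// ler_nat.
    by rewrite ler_norml; lra.
  - apply: is_cvg_geometric_series; rewrite ger0_norm//; lra.
apply/andP; split.
  apply: limr_ge => //; exists K => // n /= Kn; rewrite -(subnKC Kn) partial_potentialB.
  by have := sum_increment_bounds K (n - K) x; lra.
apply: limr_le => //; exists K => // n /= Kn; rewrite -(subnKC Kn) partial_potentialB.
by have := sum_increment_bounds K (n - K) x; lra.
Qed.

Lemma potential_norm x : `|potential x| <= 2.
Proof.
have := potential_bounds 0 x.
by rewrite /partial_potential big_ord0 !expr0 ler_norml; lra.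
Qed.

Lemma expr_small (q : R) (eps : R) : 0 <= q < 1 -> 0 < eps ->
  exists K, forall k, (K <= k)%N -> q ^+ k <= eps.
Proof.
move=> /andP[q0 q1] eps0.
have : q ^+ k @[k --> \oo] --> (0 : R).
  by apply: cvg_expr; rewrite ger0_norm.
move/cvgrPdist_le/(_ _ eps0) => [K _ hK]; exists K => k Kk.
by have := hK k Kk; rewrite /= sub0r normrN ger0_norm ?exprn_ge0.
Qed.

(** Steps after [K] lower the potential only through truncation, by at most [2 * 4^-K] per letter in
    total. *)
Lemma birkhoff_potential_level K : exists C, forall n x,
  birkhoff n (level K) x - C - n%:R * (2 * 4^-1 ^+ K) <= birkhoff n potential x.
Proof.
have [C hC] := partial_potential_birkhoff K; exists C => n x.
apply: (@le_trans _ _ (birkhoff n (fun y => 1 * partial_potential K y + (- (2 * 4^-1 ^+ K))) x)).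
  rewrite birkhoff_lin birkhoff_cst; have := hC n x; rewrite ler_norml; lra.
by apply: le_birkhoff => y; have := potential_bounds K y; lra.
Qed.

Lemma birkhoff_potential_ge eps : 0 < eps -> exists C, forall n x,
  - C - n%:R * eps <= birkhoff n potential x.
Proof.
move=> eps0; have [||K hK] := expr_small 4^-1 (eps / 2); first lra.
  by rewrite divr_gt0.
have [C hC] := birkhoff_potential_level K; exists C => n x.
apply: le_trans (hC n x).
have [_ l0 _] := level_spec K.
have : 0 <= birkhoff n (level K) x by apply: sumr_ge0 => j _.
have : n%:R * (2 * 4^-1 ^+ K) <= n%:R * eps :> R.
  by rewrite ler_wpM2l//; have := hK K (leqnn _); lra.
lra.
Qed.

(** The potential may depend on infinitely many letters, so its mean is controlled through a partial
    sum raised by the bound on the tail. *)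
Lemma potential_majorant eps : 0 < eps -> exists m f c,
  [/\ local_upto m f, forall x, potential x <= f x, has_mean p f c & c <= eps].
Proof.
move=> eps0; have [||K hK] := expr_small 2^-1 (eps / 3); first lra.
  by rewrite divr_gt0.
have [m hm] := partial_potential_local K.
have [c hc cK] := partial_potential_mean K.
exists m, (fun x => 1 * partial_potential K x + 2 * 2^-1 ^+ K).
exists (1 * c + 2 * 2^-1 ^+ K); split.
- exact: (local_upto_op1 (fun t => 1 * t + 2 * 2^-1 ^+ K)).
- by move=> x; have := potential_bounds K x; lra.
- by apply: has_mean_lin => //; exact: has_mean_cst.
have : (4^-1 : R) ^+ K <= 2^-1 ^+ K by rewrite lerXn2r ?nnegrE// lef_pV2 ?posrE// ler_nat.
have := hK K (leqnn _); lra.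
Qed.

(* Completing the square, [t^2 >= 2 a t - a^2], makes the quadratic penalty
   of [level] linear in the deviation. *)
Lemma birkhoff_potential_dev w a c : 0 < c -> exists b C, [/\ 0 < b, b <= 1 &
  forall n x,
  b * (2 * a * birkhoff n (word_dev w) x - n%:R * a ^+ 2 - n%:R * c) - C <=
  birkhoff n potential x].
Proof.
move=> c0; have [||K0 hK0] := expr_small 2^-1 c => //; first lra.
(* The step must come late: its penalty has weight [b = 2^-K], the later losses are at most [b ^+ 2]
   per letter, and [b <= c] puts them below [b * c]. *)
have [K KK0 wK] := target_word_unbounded w K0.
pose b : R := 2^-1 ^+ K; have b0 : 0 < b by rewrite exprn_gt0.
have b1 : b <= 1 by rewrite exprn_ile1//; lra.
have [C hC] := birkhoff_potential_level K.+1.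
set N := averaging_length K (level K).
have N0 : (0 < N)%N := averaging_length_gt0 K.
exists b, (C + `|b * (2 * a)| * (N%:R * (2 * 1))); split=> // n x.
apply: le_trans (hC n x).
have hlev y : b * (2 * a) * ergodic_avg N (word_dev w) y + (- (b * a ^+ 2)) <= level K.+1 y.
  rewrite /= /penalised wK -/N -/b.
  have : 0 <= Num.max (ergodic_avg N (level K) y - 4^-1 ^+ K) 0.
    by rewrite le_max lexx orbT.
  set t := ergodic_avg N (word_dev w) y.
  have : 0 <= b * (t - a) ^+ 2 by rewrite mulr_ge0 ?sqr_ge0// ltW.
  have -> : b * (t - a) ^+ 2 = b * t ^+ 2 - b * (2 * a) * t + b * a ^+ 2 by ring.
  lra.
have := le_birkhoff n _ _ x hlev; rewrite birkhoff_lin birkhoff_cst.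
have := birkhoff_ergodic_avg N n _ x 1 N0 ler01 (word_dev_le1 w).
set s := birkhoff n (ergodic_avg N _) x; set s' := birkhoff n (word_dev w) x => h1 h2.
have h3 : - (`|b * (2 * a)| * (N%:R * (2 * 1))) <= b * (2 * a) * (s - s').
  rewrite lerNl; apply: le_trans (ler_norm _) _.
  by rewrite normrN normrM ler_wpM2l.
have h4 : n%:R * (2 * 4^-1 ^+ K.+1) <= n%:R * (b * c).
  rewrite ler_wpM2l// exprS.
  have -> : (4^-1 : R) ^+ K = b * b.
    by rewrite /b -exprMn; congr (_ ^+ _); field.
  have : b * b <= b * c by rewrite ler_pM2l// hK0.
  have : 0 <= b * c by rewrite mulr_ge0// ltW.
  lra.
move: h2 h3 h4; rewrite !mulrBr !mulrA; lra.
Qed.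

End Potential.

(** * Invariant measures on the two-sided shift *)

Definition agree_within (m : nat) (x y : int -> bool) :=
  forall i : int, (`|i| <= m)%N -> x i = y i.

(** An algebra of clopen sets that generates the Borel sets; measures are compared and sets
    approximated through it. *)
Definition finitary (A : set Sigma2) :=
  exists m, forall x y : Sigma2, agree_within m x y -> A x -> A y.

Lemma agree_within_sym m x y : agree_within m x y -> agree_within m y x.
Proof. by move=> xy i im; rewrite xy. Qed.

Lemma agree_within_trans m x y z :
  agree_within m x y -> agree_within m y z -> agree_within m x z.
Proof. by move=> xy yz i im; rewrite xy// yz. Qed.

Lemma agree_within_le m n x y : (m <= n)%N ->
  agree_within n x y -> agree_within m x y.
Proof. by move=> mn xy i im; apply: xy; exact: leq_trans mn. Qed.

Lemma agree_within_nbhs m (x : cantor_Z) : \forall y \near x, agree_within m x y.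
Proof.
have : \forall y \near x, forall j : 'I_(2 * m).+1,
    y (j%:Z - m%:Z) = x (j%:Z - m%:Z).
  apply: (@filter_forall cantor_Z _ (fun (j : 'I_(2 * m).+1) y =>
    y (j%:Z - m%:Z) = x (j%:Z - m%:Z)) (nbhs x) _) => j.
  have := @proj_continuous int (fun=> bool) (j%:Z - m%:Z) x.
  by move=> /(_ _ (discrete_set1 _)).
apply: filterS => y xy i im.
have jP : (absz (i + m%:Z)%R < (2 * m).+1)%N by lia.
have := xy (Ordinal jP); rewrite /= (_ : (absz (i + m%:Z))%:Z - m%:Z = i) //.
by lia.
Qed.

Lemma finitary_open A : finitary A -> open (A : set cantor_Z).
Proof.
move=> [m hm]; rewrite openE => x Ax; apply: filterS (agree_within_nbhs m x).
by move=> y xy; exact: hm xy Ax.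
Qed.

(** The filter generated by the windows around [x] converges to [x] in each coordinate, hence in the
    product topology. *)
Lemma open_agree_within (U : set cantor_Z) x : open U -> U x ->
  exists m, forall y, agree_within m x y -> U y.
Proof.
move=> oU Ux.
pose F := filter_from [set: nat] (fun m => [set y | agree_within m x y]).
have FF : Filter F.
  apply: filter_from_filter; first by exists 0%N.
  move=> i j _ _; exists (maxn i j) => // y xy; split.
    exact: agree_within_le (leq_maxl _ _) xy.
  exact: agree_within_le (leq_maxr _ _) xy.
suff : F --> (x : cantor_Z).
  move=> /(_ U)[|m _ mU]; first by apply: open_nbhs_nbhs.
  by exists m => y xy; exact: mU.
apply/cvg_sup => i; apply/cvg_image.
  rewrite eqEsubset; split=> // b _; exists (fun=> b) => //.
move=> W /principal_filterP Wx.
exists [set y | W (y i)]; first by exists (absz i) => // y xy; rewrite /= -(xy i).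
by rewrite eqEsubset; split => [b [y Wy <-]//|b Wb]; exists (fun=> b).
Qed.

Lemma finitary_measurable A : finitary A -> measurable A.
Proof. by move=> /finitary_open; exact: sub_sigma_algebra. Qed.

Definition finitary_interior (U : set Sigma2) m : set Sigma2 :=
  [set x | forall y, agree_within m x y -> U y].

Lemma finitary_interior_finitary U m : finitary (finitary_interior U m).
Proof.
by exists m => x y xy hx z yz; apply: hx; exact: agree_within_trans yz.
Qed.

Lemma open_bigcup_finitary (U : set Sigma2) : open (U : set cantor_Z) ->
  U = \bigcup_m finitary_interior U m.
Proof.
move=> oU; rewrite eqEsubset; split=> [x Ux|x [m _ hx]]; last exact: hx.
by have [m hm] := open_agree_within U x oU Ux; exists m.
Qed.

(** Finitary sets are open, and an open set is the countable union of its finitary interiors. *)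
Lemma Sigma2_measurableE : @measurable _ Sigma2 = <<s finitary >>.
Proof.
rewrite eqEsubset; split.
  apply: smallest_sub; first exact: smallest_sigma_algebra.
  move=> U /open_bigcup_finitary ->; apply: sigma_algebra_bigcup => m.
  apply: sub_sigma_algebra; exact: finitary_interior_finitary.
apply: smallest_sub; first exact: smallest_sigma_algebra.
by move=> A /finitary_open; exact: sub_sigma_algebra.
Qed.

Lemma finitaryC A : finitary A -> finitary (~` A).
Proof.
by move=> [m hm]; exists m => x y xy nAx Ay; apply/nAx/(hm y x) => // i /xy.
Qed.

Lemma finitaryI A B : finitary A -> finitary B -> finitary (A `&` B).
Proof.
move=> [m hm] [n hn]; exists (maxn m n) => x y xy [Ax Bx]; split.
  by apply: hm Ax; exact: agree_within_le (leq_maxl _ _) xy.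
by apply: hn Bx; exact: agree_within_le (leq_maxr _ _) xy.
Qed.

Lemma finitaryT : finitary setT.
Proof. by exists 0%N. Qed.

Lemma finitary_word_set n (P : set (seq bool)) :
  finitary [set x | P (first_letters n x)].
Proof.
exists n => x y xy /=; congr P; apply/eq_in_map => k; rewrite mem_iota => kn.
by apply: xy; lia.
Qed.

Lemma iter_sigmaE n (x : Sigma2) i : iter n sigma x i = x (i + n%:Z).
Proof.
elim: n i => [|n IH] i; first by rewrite addr0.
by rewrite iterS /sigma IH; congr x; lia.
Qed.

Lemma finitary_iter_sigma n A : finitary A -> finitary (iter n sigma @^-1` A).
Proof.
move=> [m hm]; exists (m + n)%N => x y xy; apply: hm => i im.
by rewrite !iter_sigmaE; apply: xy; lia.
Qed.

(* Shifting far enough moves the window of a finitary set to positive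
   coordinates. *)
Lemma finitary_shift_word_set A : finitary A -> exists m n (P : set (seq bool)),
  iter m sigma @^-1` A = [set x | P (first_letters n x)].
Proof.
(* [first_letters] starts at coordinate 1, so the window from [-m] to [m] is moved by [m.+1], onto
   coordinates 1 to [2 * m + 1]. *)
move=> [m hm]; exists m.+1, (2 * m).+1.
pose dec (w : seq bool) : Sigma2 := fun i => nth false w (absz (i + m%:Z)).
exists [set w | A (dec w)].
have H (x : Sigma2) : agree_within m (iter m.+1 sigma x) (dec (first_letters (2 * m).+1 x)).
  move=> i im; rewrite iter_sigmaE /dec nth_mkseq; last by lia.
  by congr x; lia.
rewrite eqEsubset; split=> x; first exact: (hm _ _ (H x)).
exact: (hm _ _ (agree_within_sym _ _ _ (H x))).
Qed.

Lemma first_letters_iter_sigma j n (x : Sigma2) :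
  first_letters n (iter j sigma x) =
  mkseq (iter j behead_stream (fun k => x k.+1%:Z)) n.
Proof.
apply: eq_mkseq => k; rewrite iter_sigmaE iter_beheadE; congr x; lia.
Qed.

Lemma measure_finType_bigcup {R : realType} {d} {T : measurableType d}
    (mu : {measure set T -> \bar R}) (I : finType) (F : I -> set T) :
  (forall i, measurable (F i)) -> trivIset setT F ->
  mu (\bigcup_i F i) = (\sum_(i : I) mu (F i))%E.
Proof.
move=> mF tF; rewrite measure_fin_bigcup//; last exact: finite_finset.
have -> : [set: I] = [set` index_enum I].
  by apply/seteqP; split=> i _ //=; rewrite mem_index_enum.
by rewrite -fsbig_seq ?index_enum_uniq.
Qed.

Section InvariantMeasures.
Context {R : realType}.
Implicit Types nu mu : probability Sigma2 R.

Lemma invariant_iter nu n A : invariant_measure sigma nu -> finitary A ->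
  nu (iter n sigma @^-1` A) = nu A.
Proof.
move=> inv fA; elim: n => [//|n IH].
have := inv _ (finitary_measurable _ (finitary_iter_sigma n A fA)).
rewrite IH => <-; congr (nu _); apply/funext => x /=.
by rewrite /preimage /= -iterS iterSr.
Qed.

Lemma measurable_word_set n (P : set (seq bool)) :
  measurable [set x : Sigma2 | P (first_letters n x)].
Proof. exact: (finitary_measurable _ (finitary_word_set n P)). Qed.

Lemma measurable_word_fun n (F : seq bool -> R) (A : set Sigma2) :
  measurable A -> measurable_fun A (fun x : Sigma2 => F (first_letters n x)).
Proof.
move=> mA _ Y mY; apply: measurableI => //.
exact: (measurable_word_set n (fun w => Y (F w))).
Qed.

Lemma word_fun_integrable nu n (F : seq bool -> R) :
  nu.-integrable setT (EFin \o (fun x : Sigma2 => F (first_letters n x))).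
Proof.
apply: measurable_bounded_integrable => //.
- exact: fin_num_fun_lty.
- exact: measurable_word_fun.
have [B _ hB] := local_upto_bounded n (fun x => F (mkseq x n)) (local_upto_mkseq F n).
exists B; split; first exact: num_real.
by move=> C BC x _ /=; apply: le_trans (hB _) (ltW BC).
Qed.

Lemma word_fun_sum n (F : seq bool -> R) (x : Sigma2) :
  F (first_letters n x) = \sum_(w : n.-tuple bool)
    F w * \1_[set y : Sigma2 | first_letters n y = w] x.
Proof.
have sz : size (first_letters n x) == n by rewrite size_mkseq.
rewrite (bigD1 (Tuple sz))//= indicE mem_set// mulr1 big1 ?addr0// => w wx.
rewrite indicE memNset ?mulr0// => xw; move/eqP: wx; apply.
exact: val_inj.
Qed.

Lemma Rintegral_word_fun nu n (F : seq bool -> R) :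
  \int[nu]_x F (first_letters n x) = \sum_(w : n.-tuple bool)
    F w * fine (nu [set y : Sigma2 | first_letters n y = w]).
Proof.
pose I w : Sigma2 -> R := \1_[set y : Sigma2 | first_letters n y = w].
have mw (w : seq bool) : measurable [set y : Sigma2 | first_letters n y = w].
  exact: (measurable_word_set n [set u | u = w]).
have Iint w : nu.-integrable setT (EFin \o I w).
  by apply: integrable_indic => //; exact: fin_num_fun_lty.
under eq_Rintegral do rewrite word_fun_sum.
rewrite /Rintegral.
under eq_integral do rewrite -sumEFin.
rewrite integral_sum//=; last first.
  by move=> w; exact: (integrableZl measurableT (F w) (Iint w)).
have E (w : n.-tuple bool) : (\int[nu]_x (F w * I w x)%:E =
    (F w * fine (nu [set y : Sigma2 | first_letters n y = w]))%:E)%E.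
  under eq_integral do rewrite EFinM.
  rewrite integralZl// /I.
  have -> := @integral_indic _ _ _ nu setT measurableT _ (mw w).
  by rewrite setIT EFinM fineK//; exact: fin_num_measure.
  exact: Iint.
by rewrite (eq_bigr _ (fun w _ => E w)) sumEFin.
Qed.

(** Finitary sets generate and are stable under intersection; invariance moves each to positive
    coordinates, where it is a disjoint union of word cylinders. *)
Lemma invariant_measure_eq nu mu : invariant_measure sigma nu ->
  invariant_measure sigma mu ->
  (forall w : seq bool, nu [set y : Sigma2 | first_letters (size w) y = w] =
     mu [set y : Sigma2 | first_letters (size w) y = w]) ->
  forall A, measurable A -> nu A = mu A.
Proof.
move=> inu imu E A mA.
apply: (measure_unique finitary (fun=> setT)) => //.
- exact: Sigma2_measurableE.
- exact: finitaryI.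
- by move=> _; exact: finitaryT.
- by apply/seteqP; split => // x _; exists 0%N.
- move=> B fB; have [m [n [P hP]]] := finitary_shift_word_set B fB.
  change (nu B = mu B); rewrite -(invariant_iter nu m B)// -(invariant_iter mu m B)// hP.
  have S (xi : probability Sigma2 R) : xi [set x | P (first_letters n x)] =
      (\sum_(w : n.-tuple bool) xi [set y : Sigma2 | P w /\ first_letters n y = w])%E.
    rewrite -measure_finType_bigcup//=; last 2 first.
    - move=> w; exact: (measurable_word_set n [set u : seq bool | P w /\ u = w]).
    - by move=> u v _ _ [x [/= [_ ->] [_ /val_inj]]].
    congr (xi _); apply/seteqP; split=> x /=; last by move=> [w _ /= [Pw ->]].
    move=> Px; have sz : size (first_letters n x) == n by rewrite size_mkseq.
    by exists (Tuple sz).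
  rewrite !S; apply: eq_bigr => w _; have := E w; rewrite size_tuple => Ew.
  have [Pw|Pw] := pselect (P w).
    rewrite (_ : mkset _ = [set y | first_letters n y = w])//.
    by apply/seteqP; split=> x /= => [[]|].
  by rewrite (_ : mkset _ = set0) ?measure0//; apply/seteqP; split=> x /= => [[]|].
- by move=> _; rewrite fin_num_fun_lty.
Qed.

End InvariantMeasures.

(** * The Bernoulli measure *)

Section BernoulliMeasure.
Context {R : realType}.
Variable p : R.
Hypotheses (p_ge0 : 0 <= p) (p_lt1 : p < 1).

Let U : probability (measurableTypeR R) R := uniform_prob (@ltr01 R).

Let itvE (a b : R) : [set t : R | a <= t < b] = `[a, b[%classic.
Proof. by apply/seteqP; split=> t; rewrite /= in_itv. Qed.

Lemma uniform01_itv (a b : R) : 0 <= a -> a <= b -> b <= 1 ->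
  U [set t | a <= t < b] = (b - a)%:E.
Proof.
move=> a0 ab b1; rewrite itvE /U/= /uniform_prob.
rewrite (eq_integral (fun=> 1%:E)); last first.
  move=> t; rewrite inE /= in_itv /= /uniform_pdf subr0 invr1 => /andP[at_ tb].
  by rewrite (le_trans a0 at_)/= (ltW (lt_le_trans tb b1)).
rewrite integral_cst//= mul1e lebesgue_measure_itv/= lte_fin.
by case: ltP => // ba; rewrite (_ : b = a) ?subrr//; apply/le_anti/andP.
Qed.

Lemma uniform01_unit (A : set (measurableTypeR R)) : measurable A ->
  U A = U ([set t | 0 <= t < 1] `&` A).
Proof.
move=> mA; have mI : measurable ([set t | 0 <= t < 1] : set (measurableTypeR R)).
  by rewrite itvE; exact: measurable_itv.
have U0 : U (~` [set t | 0 <= t < 1]) = 0%:E.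
  by rewrite probability_setC// uniform01_itv// subr0 subee.
rewrite (measureDI U mA mI) setIC.
rewrite (@subset_measure0 _ _ _ U (A `\` _) (~` [set t | 0 <= t < 1])) ?add0e//.
- exact: measurableD.
- exact: measurableC.
Qed.

(* The map [next_point] preserves Lebesgue measure on [0,1) and its two
   branches carry the weights p and 1 - p (at p = 0 the first branch is
   empty). *)
Definition next_point (t : R) : R := if t < p then t / p else (t - p) / (1 - p).

Definition digits (t : R) : nat -> bool := fun k => iter k next_point t < p.

Lemma mkseq_digits t n :
  mkseq (digits t) n.+1 = (t < p) :: mkseq (digits (next_point t)) n.
Proof.
rewrite mkseq_behead; congr (_ :: _); apply: eq_mkseq => k.
by rewrite /behead_stream /digits iterSr.
Qed.

Lemma next_point_itv t : 0 <= t < 1 -> 0 <= next_point t < 1.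
Proof.
move=> /andP[t0 t1]; rewrite /next_point; case: ltP => tp.
  have p0 : 0 < p by exact: le_lt_trans tp.
  by rewrite divr_ge0//= ltr_pdivrMr// mul1r.
have q0 : 0 < 1 - p by rewrite subr_gt0.
by rewrite divr_ge0 ?subr_ge0// ?ltW//= ltr_pdivrMr// mul1r ltrD2r.
Qed.

(** Prepending a letter pulls the interval of the tail back through an affine branch of
    [next_point], which multiplies its length by the weight of the letter. *)
Lemma digits_word_itv (w : seq bool) : exists a, [/\ 0 <= a,
  a + word_weight p w <= 1 & forall t,
  0 <= t < 1 /\ mkseq (digits t) (size w) = w <-> a <= t < a + word_weight p w].
Proof.
have p_le1 := ltW p_lt1.
elim: w => [|b w [a [a0 a1 ha]]].
  by exists 0; split=> //; rewrite /word_weight big_nil add0r// => t; split=> // -[].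
have ww0 : 0 <= word_weight p w by exact: word_weight_ge0.
have q0 : 0 < 1 - p by rewrite subr_gt0.
have wS : word_weight p (b :: w) = bernoulli_weight p b * word_weight p w.
  by rewrite /word_weight big_cons.
have H t : mkseq (digits t) (size (b :: w)) = b :: w <->
    (t < p) = b /\ mkseq (digits (next_point t)) (size w) = w.
  by rewrite [size _]/= mkseq_digits; split=> [[-> ->]|[-> ->]].
case: b wS H => /= wS H; rewrite wS.
  (* At [p = 0] no point of the unit interval has first digit [true], which matches an empty
     interval of length 0. *)
  have [p0|p0] := ltP 0 p; last first.
    have p00 : p = 0 by apply/le_anti/andP.
    exists 0; rewrite (_ : p * _ = 0) ?addr0; last by rewrite p00 mul0r.
    split=> // t; split.
      move=> [/andP[t0 _] /H[tp _]].
      by have := le_lt_trans t0 tp; rewrite p00 ltxx.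
    by move=> /andP[/le_lt_trans h /h]; rewrite ltxx.
  exists (p * a); split.
  - by rewrite mulr_ge0.
  - rewrite -mulrDr; apply: le_trans p_le1; rewrite -[leRHS]mulr1.
    by rewrite ler_pM2l.
  move=> t; rewrite -mulrDr; split.
    move=> [t01 /H[tp E]]; have := next_point_itv t t01.
    move=> /(conj E)/and_comm/ha; rewrite /next_point tp.
    by rewrite ler_pdivlMr// ltr_pdivrMr// ![_ * p]mulrC.
  move=> /andP[h1 h2].
  have t0 : 0 <= t by apply: le_trans h1; rewrite mulr_ge0.
  have tp : t < p.
    by apply: lt_le_trans h2 _; rewrite -[leRHS]mulr1 ler_pM2l.
  have t01 : 0 <= t < 1 by rewrite t0 (lt_trans tp).
  split=> //; apply/H; split=> //; apply: (proj2 (proj2 (ha _) _)).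
  rewrite /next_point tp ler_pdivlMr// ltr_pdivrMr// ![_ * p]mulrC.
  by rewrite h1.
exists (p + (1 - p) * a); split.
- by rewrite addr_ge0// mulr_ge0// ltW.
- have : (1 - p) * (a + word_weight p w) <= (1 - p) * 1 by rewrite ler_pM2l.
  by lra.
move=> t; have -> : (p + (1 - p) * a <= t < p + (1 - p) * a + (1 - p) * word_weight p w)
   = (a <= (t - p) / (1 - p) < a + word_weight p w).
  rewrite ler_pdivlMr// ltr_pdivrMr// ![_ * (1 - p)]mulrC mulrDr.
  by rewrite lerBrDl ltrBlDl addrA.
split.
  move=> [t01 /H[tp E]]; have := next_point_itv t t01.
  by move=> /(conj E)/and_comm/ha; rewrite /next_point tp.
move=> h; have /andP[h1 h2] := h.
have pt : p <= t.
  have := le_trans a0 h1; rewrite pmulr_lge0 ?invr_gt0//.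
  by rewrite subr_ge0.
have t01 : 0 <= t < 1.
  rewrite (le_trans p_ge0 pt)/=; have := lt_le_trans h2 a1.
  by rewrite ltr_pdivrMr// mul1r ltrD2r.
have tp : (t < p) = false by apply/negbTE; rewrite -leNgt.
split=> //; apply/H; split=> //.
by apply: (proj2 (proj2 (ha _) _)); rewrite /next_point tp.
Qed.

Lemma measurable_next_point :
  measurable_fun [set: measurableTypeR R] (next_point : measurableTypeR R -> measurableTypeR R).
Proof.
apply: measurable_fun_ifT.
- by apply: measurable_fun_ltr => //; exact: measurable_cst.
- by apply: measurable_funM.
- by apply: measurable_funM => //; exact: measurable_funB.
Qed.

Lemma measurable_digits_word (w : seq bool) :
  measurable ([set t | mkseq (digits t) (size w) = w] : set (measurableTypeR R)).
Proof.
elim: w => [|b w IH].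
  by rewrite (_ : mkset _ = setT)//; apply/seteqP; split.
rewrite (_ : mkset _ = [set t | (t < p) = b] `&`
  next_point @^-1` [set t | mkseq (digits t) (size w) = w]).
  apply: measurableI.
    have : measurable_fun [set: measurableTypeR R] (fun t : measurableTypeR R => t < p).
      by apply: measurable_fun_ltr => //; exact: measurable_cst.
    by move=> /(_ measurableT [set b] I); rewrite setTI.
  by have := measurable_next_point measurableT _ IH; rewrite setTI.
apply/seteqP; split=> t /=; rewrite mkseq_digits; first by move=> [-> ->].
by move=> [-> ->].
Qed.

Lemma uniform01_digits_word (w : seq bool) :
  U [set t | mkseq (digits t) (size w) = w] = (word_weight p w)%:E.
Proof.
have [a [a0 a1 ha]] := digits_word_itv w.
rewrite uniform01_unit; last exact: measurable_digits_word.
rewrite (_ : _ `&` _ = [set t | a <= t < a + word_weight p w]).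
  rewrite uniform01_itv ?lerDl ?word_weight_ge0 ?(ltW p_lt1)//.
  by rewrite addrAC subrr add0r.
by apply/seteqP; split=> t /= /ha.
Qed.

Let eqtuple (n : nat) (s : nat -> bool) (f : {ffun 'I_n -> bool}) :
  (mkseq s (size (codom f)) = codom f) <-> (forall j : 'I_n, s j = f j).
Proof.
rewrite size_codom card_ord /mkseq -val_enum_ord -map_comp codomE.
split=> [/eq_in_map H j|H]; first by apply: H; rewrite mem_enum.
by apply: eq_map => j; exact: H.
Qed.

Lemma measurable_digits_cylinder n (f : {ffun 'I_n -> bool}) :
  measurable ([set t | forall j : 'I_n, digits t j = f j] : set (measurableTypeR R)).
Proof.
have := measurable_digits_word (codom f).
by rewrite (_ : mkset _ = [set t | forall j : 'I_n, digits t j = f j])//;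
  apply/seteqP; split=> t /= /eqtuple.
Qed.

Lemma uniform01_digits_cylinder n (f : {ffun 'I_n -> bool}) :
  U [set t | forall j : 'I_n, digits t j = f j] =
  (\prod_j bernoulli_weight p (f j))%:E.
Proof.
have := uniform01_digits_word (codom f).
rewrite (_ : mkset _ = [set t | forall j : 'I_n, digits t j = f j]).
  by move=> ->; rewrite /word_weight codomE big_map big_enum.
by apply/seteqP; split=> t /= /eqtuple.
Qed.

(** Independent one-sided digits are distributed over the integers; injectivity of [pickle] keeps
    the coordinates independent. *)
Let stretch (t : measurableTypeR R) : Sigma2 := fun i => digits t (pickle i).

Lemma pickle_bound (J : seq int) :
  exists N, forall i, i \in J -> (pickle i < N)%N.
Proof.
elim: J => [|i J [N hN]]; first by exists 0%N.
exists (maxn (pickle i).+1 N) => k; rewrite inE => /predU1P[->|/hN]; lia.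
Qed.

Let measurable_digits_set n (P : set (seq bool)) :
  measurable ([set t | P (mkseq (digits t) n)] : set (measurableTypeR R)).
Proof.
rewrite (_ : mkset _ = \bigcup_(w : n.-tuple bool)
    [set t | P w /\ mkseq (digits t) n = w]).
  apply: fin_bigcup_measurable => [|w _]; first exact: finite_finset.
  have [Pw|Pw] := pselect (P w).
    rewrite (_ : mkset _ = [set t | mkseq (digits t) (size w) = w]).
      exact: measurable_digits_word.
    by rewrite size_tuple; apply/seteqP; split=> t /= => [[]|].
  by rewrite (_ : mkset _ = set0)//; apply/seteqP; split=> t /= => [[]|].
apply/seteqP; split=> t /= => [Pt|[w _ [Pw ->]]//].
have sz : size (mkseq (digits t) n) == n by rewrite size_mkseq.
by exists (Tuple sz).
Qed.

Lemma measurable_stretch : measurable_fun setT stretch.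
Proof.
apply: (measurability finitary); first exact: Sigma2_measurableE.
move=> _ [A [m hm] <-]; rewrite setTI.
have [N hN] := pickle_bound [seq j%:Z - m%:Z | j <- iota 0 (2 * m).+1].
pose dec (w : seq bool) : Sigma2 := fun i => nth false w (pickle i).
have H t : agree_within m (stretch t) (dec (mkseq (digits t) N)).
  move=> i im; rewrite /dec nth_mkseq//; apply: hN.
  apply/mapP; exists (absz (i + m%:Z)); last by lia.
  by rewrite mem_iota; lia.
rewrite (_ : _ @^-1` _ = [set t | A (dec (mkseq (digits t) N))]).
  exact: (measurable_digits_set N [set w | A (dec w)]).
apply/seteqP; split=> t; first exact: (hm _ _ (H t)).
exact: (hm _ _ (agree_within_sym _ _ _ (H t))).
Qed.

(** The law of [stretch] under the uniform measure. A box is split into digit cylinders of a common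
    length [N]; exchanging the sum over digit words with the product over positions leaves one
    factor per position. *)
Lemma bernoulli_measure : exists mu : probability Sigma2 R,
  forall (J : seq int) (v : int -> bool), uniq J ->
  mu [set x | forall i, i \in J -> x i = v i] =
  (\prod_(i <- J) bernoulli_weight p (v i))%:E.
Proof.
exists (distribution U (mfun_Sub (mem_set measurable_stretch))) => J v uJ.
rewrite /distribution /pushforward /=.
have [N hN] := pickle_bound J.
pose C (j : nat) (b : bool) := all (fun i => (pickle i == j) ==> (b == v i)) J.
have CP t : (forall i, i \in J -> stretch t i = v i) <->
    forall j : 'I_N, C j (digits t j).
  split=> [H j|H i iJ].
    by apply/allP => i iJ; apply/implyP => /eqP <-; rewrite -(H i iJ).
  have := H (Ordinal (hN i iJ)) => /allP/(_ i iJ); rewrite eqxx /=.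
  by move=> /eqP.
rewrite (_ : _ @^-1` _ = \bigcup_(f : {ffun 'I_N -> bool})
    [set t | (forall j : 'I_N, C j (f j)) /\ forall j : 'I_N, digits t j = f j]); last first.
  apply/seteqP; split=> t /=.
    move=> /CP H; exists [ffun j : 'I_N => digits t j] => //=.
    by split=> j; rewrite ffunE.
  by move=> [f _ [H1 H2]]; apply/CP => j; rewrite H2.
have E (f : {ffun 'I_N -> bool}) :
    U [set t | (forall j : 'I_N, C j (f j)) /\ forall j : 'I_N, digits t j = f j] =
    (\prod_(j < N) ((C j (f j))%:R * bernoulli_weight p (f j)))%:E.
  have [Cf|Cf] := pselect (forall j : 'I_N, C j (f j)).
    rewrite (_ : mkset _ = [set t | forall j : 'I_N, digits t j = f j]).
      rewrite uniform01_digits_cylinder; congr (_%:E).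
      by apply: eq_bigr => j _; rewrite Cf mul1r.
    by apply/seteqP; split=> t /= => [[]|].
  rewrite (_ : mkset _ = set0) ?measure0; last first.
    by apply/seteqP; split=> t /= => [[]|].
  move/existsNP : Cf => [j /negP/negbTE Cf].
  by rewrite (bigD1 j)//= Cf mul0r mul0r.
rewrite measure_finType_bigcup; last 2 first.
- move=> f; have [Cf|Cf] := pselect (forall j : 'I_N, C j (f j)).
    rewrite (_ : mkset _ = [set t | forall j : 'I_N, digits t j = f j]).
      exact: measurable_digits_cylinder.
    by apply/seteqP; split=> t /= => [[]|].
  by rewrite (_ : mkset _ = set0)//; apply/seteqP; split=> t /= => [[]|].
- move=> f g _ _ [t [/= [_ H1] [_ H2]]]; apply/ffunP => j.
  by rewrite -H1 -H2.
rewrite (eq_bigr _ (fun f _ => E f)) sumEFin; congr (_%:E).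
rewrite -(bigA_distr_bigA (fun (j : 'I_N) b => (C j b)%:R * bernoulli_weight p b)).
(* A position coding some [i] in [J] contributes the weight of [v i]; any other is summed freely and
   contributes [p + (1 - p) = 1]. *)
have q (j : nat) : \sum_(b : bool) (C j b)%:R * bernoulli_weight p b =
    \prod_(i <- J | pickle i == j) bernoulli_weight p (v i).
  have [[i iJ ij]|nij] := pselect (exists2 i, i \in J & pickle i = j).
    have Cb b : C j b = (b == v i).
      apply/allP/eqP => [/(_ i iJ)|-> k kJ].
        by rewrite ij eqxx => /eqP.
      by apply/implyP => /eqP; rewrite -ij => /(pcan_inj pickleK) ->.
    rewrite [RHS]big_mkcond (bigD1_seq i)//= ij eqxx.
    rewrite [X in _ * X]big1 ?mulr1; last first.
      move=> k /negP ki; case: eqP => // kj; case: ki; apply/eqP.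
      by apply: (pcan_inj pickleK); rewrite kj.
    rewrite (bigD1 (v i))//= Cb eqxx mul1r big1 ?addr0// => b.
    by rewrite Cb => /negbTE ->; rewrite mul0r.
  have Cb b : C j b.
    apply/allP => k kJ; apply/implyP => /eqP kj.
    by exfalso; apply: nij; exists k.
  rewrite big_bool /= !Cb !mul1r subrKC big_seq_cond big1// => k /andP[kJ /eqP kj].
  by exfalso; apply: nij; exists k.
rewrite (eq_bigr _ (fun j _ => q (val j))).
rewrite (exchange_big_dep xpredT)//= big_seq [RHS]big_seq.
apply: eq_bigr => i iJ; rewrite (big_pred1 (Ordinal (hN i iJ)))//.
Qed.

End BernoulliMeasure.

Lemma measurable_box (J : seq int) (v : int -> bool) :
  measurable [set x : Sigma2 | forall i, i \in J -> x i = v i].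
Proof.
apply: finitary_measurable; exists (\max_(i <- J) absz i)%N => x y xy /= H i iJ.
by rewrite -xy ?H//; exact: leq_bigmax_seq.
Qed.

Lemma measure_eq_boxes {R : realType} (nu mu : probability Sigma2 R) :
  (forall (J : seq int) (v : int -> bool), uniq J ->
    nu [set x : Sigma2 | forall i, i \in J -> x i = v i] =
    mu [set x : Sigma2 | forall i, i \in J -> x i = v i]) ->
  forall A, measurable A -> nu A = mu A.
Proof.
move=> E A mA.
apply: (measure_unique finitary (fun=> setT)) => //.
- exact: Sigma2_measurableE.
- exact: finitaryI.
- by move=> _; exact: finitaryT.
- by apply/seteqP; split => // x _; exists 0%N.
- move=> B [m hm]; change (nu B = mu B).
  pose J := [seq j%:Z - m%:Z | j <- iota 0 (2 * m).+1].
  have uJ : uniq J by rewrite map_inj_uniq ?iota_uniq// => i j; lia.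
  have JP i : (absz i <= m)%N -> i \in J.
    move=> im; apply/mapP; exists (absz (i + m%:Z)); last by lia.
    by rewrite mem_iota; lia.
  pose dec (w : seq bool) : Sigma2 := fun i => nth false w (absz (i + m%:Z)).
  have mB (w : seq bool) :
      measurable [set x : Sigma2 | B (dec w) /\ forall i, i \in J -> x i = dec w i].
    have [Bw|Bw] := pselect (B (dec w)).
      rewrite (_ : mkset _ = [set x : Sigma2 | forall i, i \in J -> x i = dec w i]).
        exact: measurable_box.
      by apply/seteqP; split=> t /= => [[]|].
    by rewrite (_ : mkset _ = set0)//; apply/seteqP; split=> t /= => [[]|].
  have S (xi : probability Sigma2 R) : xi B = (\sum_(w : ((2 * m).+1).-tuple bool)
      xi [set x : Sigma2 | B (dec w) /\ forall i, i \in J -> x i = dec w i])%E.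
    rewrite -measure_finType_bigcup//=; last first.
      move=> u w _ _ [x [/= [_ Hu] [_ Hw]]].
      apply: val_inj; apply: (@eq_from_nth _ false); rewrite ?size_tuple// => j jm.
      have jJ : j%:Z - m%:Z \in J by apply/mapP; exists j => //; rewrite mem_iota.
      have := Hu _ jJ; rewrite (Hw _ jJ) /dec subrK /=.
      by move=> ->.
    congr (xi _); apply/seteqP; split=> x /=; last first.
      by move=> [w _ /= [Bw H]]; apply: hm Bw => i /JP /H.
    move=> Bx; pose w := mkseq (fun j => x (j%:Z - m%:Z)) (2 * m).+1.
    have sz : size w == (2 * m).+1 by rewrite size_mkseq.
    have xw : agree_within m x (dec w).
      by move=> i im; rewrite /dec nth_mkseq; [congr x|]; lia.
    exists (Tuple sz) => //=; split; first exact: hm Bx.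
    by move=> i /mapP[j]; rewrite mem_iota => jm ->; apply: xw; lia.
  rewrite !S; apply: eq_bigr => w _.
  have [Bw|Bw] := pselect (B (dec w)).
    rewrite (_ : mkset _ = [set x : Sigma2 | forall i, i \in J -> x i = dec w i]) ?E//.
    by apply/seteqP; split=> t /= => [[]|].
  rewrite (_ : mkset _ = set0) ?measure0//.
  by apply/seteqP; split=> t /= => [[]|].
- by move=> _; rewrite fin_num_fun_lty.
Qed.

Lemma measurable_sigma : measurable_fun setT sigma.
Proof.
apply: (measurability finitary); first exact: Sigma2_measurableE.
move=> _ [A fA <-]; rewrite setTI.
exact: (finitary_measurable _ (finitary_iter_sigma 1 A fA)).
Qed.

Section BernoulliProperties.
Context {R : realType}.
Variables (p : R) (mu : probability Sigma2 R).
Hypotheses (p_ge0 : 0 <= p) (p_le1 : p <= 1).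
Hypothesis mu_box : forall (J : seq int) (v : int -> bool), uniq J ->
  mu [set x : Sigma2 | forall i, i \in J -> x i = v i] =
  (\prod_(i <- J) bernoulli_weight p (v i))%:E.

Lemma bernoulli_invariant : invariant_measure sigma mu.
Proof.
move=> A mA.
apply: (measure_eq_boxes (distribution mu (mfun_Sub (mem_set measurable_sigma)))) mA.
move=> J v uJ; pose B := [set x : Sigma2 | forall i, i \in J -> x i = v i].
change (mu (sigma @^-1` B) = mu B); rewrite (_ : _ @^-1` B =
  [set x : Sigma2 | forall i, i \in [seq j + 1 | j <- J] -> x i = v (i - 1)]); last first.
  apply/seteqP; split=> x /= H.
    by move=> i /mapP[j jJ ->]; rewrite addrK; exact: (H j jJ).
  by move=> i iJ; rewrite /sigma H ?addrK//; apply/mapP; exists i.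
rewrite /B !mu_box ?map_inj_uniq//; last exact: addIr.
by rewrite big_map; congr (_%:E); apply: eq_bigr => i _; rewrite addrK.
Qed.

Lemma bernoulli_word (w : seq bool) :
  mu [set x : Sigma2 | first_letters (size w) x = w] = (word_weight p w)%:E.
Proof.
pose v (i : int) := nth false w (absz i).-1.
rewrite (_ : mkset _ =
  [set x : Sigma2 | forall i, i \in [seq k.+1%:Z | k <- iota 0 (size w)] -> x i = v i]).
  rewrite mu_box; last by rewrite map_inj_uniq ?iota_uniq// => i j [].
  rewrite big_map /word_weight (big_nth false) /index_iota subn0.
  by congr (_%:E).
apply/seteqP; split=> x /= H.
  move=> i /mapP[k]; rewrite mem_iota add0n => kw ->.
  by rewrite /v -{1}H nth_mkseq.
apply: (@eq_from_nth _ false); rewrite size_mkseq// => k kw.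
by rewrite nth_mkseq// H//; apply/mapP; exists k => //; rewrite mem_iota.
Qed.

Lemma has_mean_uniq f c d : has_mean p f c -> has_mean p f d -> c = d.
Proof.
move=> fc fd; apply/le_anti/andP.
by split; apply: (has_mean_le p p_ge0 p_le1 f f).
Qed.

Lemma has_mean_sum (I : Type) (r : seq I) (F : I -> (nat -> bool) -> R) (c : I -> R) :
  (forall i, has_mean p (F i) (c i)) ->
  has_mean p (fun x => \sum_(i <- r) F i x) (\sum_(i <- r) c i).
Proof.
move=> FC; elim: r => [|i r IH].
  rewrite big_nil (_ : (fun _ => _) = fun=> 0); first exact: has_mean_cst.
  by apply/funext => x; rewrite big_nil.
rewrite big_cons (_ : (fun _ => _) = fun x => 1 * F i x + \sum_(j <- r) F j x).
  by rewrite -[c i]mul1r; exact: has_mean_lin.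
by apply/funext => x; rewrite big_cons mul1r.
Qed.

(** Links transfer means to integrals: [f] is a combination of word indicators, and each of these is
    [word_dev], of mean zero, plus the weight, which is its [mu]-measure. *)
Lemma bernoulli_Rintegral m f c : local_upto m f -> has_mean p f c ->
  \int[mu]_x f (fun k => (x : Sigma2) k.+1%:Z) = c.
Proof.
move=> fm fc; pose F (w : seq bool) := f (nth false w).
have fF (y : nat -> bool) : f y = F (mkseq y m).
  by apply: fm => k km; rewrite nth_mkseq.
rewrite (eq_Rintegral mu (g := fun x : Sigma2 => F (first_letters m x))); last first.
  by move=> x _ /=; rewrite fF.
rewrite Rintegral_word_fun; apply: has_mean_uniq fc.
rewrite (_ : f = fun y => \sum_(w : m.-tuple bool) (F w * word_dev p w y + F w * word_weight p w)).
  apply: has_mean_sum => w; have := bernoulli_word w; rewrite size_tuple => -> /=.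
  rewrite -[X in has_mean _ _ X]add0r -(mulr0 (F w)).
  apply: has_mean_lin; last exact: has_mean_cst.
  exact: has_mean_word_dev.
apply/funext => y; rewrite fF.
have sz : size (mkseq y m) == m by rewrite size_mkseq.
rewrite (bigD1 (Tuple sz))//= /word_dev size_tuple eqxx mulrBr subrK mulr1.
rewrite big1 ?addr0// => w wy; rewrite size_tuple.
have -> : (mkseq y m == w) = false.
  by apply: contraNF wy => /eqP E; apply/eqP/val_inj.
by rewrite sub0r mulrN addNr.
Qed.

End BernoulliProperties.

(** * Growth rates of weighted shifts *)

(** The [false] put before each word makes the length at least [n], so position [q] is settled once
    [q.+1] words are written. *)
Definition word_list (n : nat) : seq bool :=
  flatten [seq false :: odflt [::] (@unpickle (seq bool) j) | j <- iota 0 n].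

Definition universal_stream (i : int) : bool :=
  nth false (word_list (absz i).+1) (absz i).

Lemma word_listS n : word_list n.+1 =
  word_list n ++ false :: odflt [::] (@unpickle (seq bool) n).
Proof.
by rewrite /word_list -addn1 iotaD map_cat flatten_cat /= cats0.
Qed.

Lemma size_word_list n : (n <= size (word_list n))%N.
Proof. by elim: n => // n IH; rewrite word_listS size_cat /=; lia. Qed.

Lemma nth_word_list n m q : (n <= m)%N -> (q < size (word_list n))%N ->
  nth false (word_list m) q = nth false (word_list n) q.
Proof.
move=> /subnKC <-; elim: (m - n)%N => [|k IH] qn; first by rewrite addn0.
rewrite addnS word_listS nth_cat -IH//.
suff -> : (q < size (word_list (n + k)))%N by [].
apply: leq_trans qn _; elim: (k) => [|l]; first by rewrite addn0.
by rewrite addnS word_listS size_cat; lia.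
Qed.

Lemma universal_streamE n q : (q < size (word_list n))%N ->
  universal_stream q%:Z = nth false (word_list n) q.
Proof.
move=> qn; rewrite /universal_stream absz_nat.
have qq : (q < size (word_list q.+1))%N := size_word_list q.+1.
by case: (leqP n q.+1) => h; [|apply/esym]; apply: nth_word_list => //; exact: ltnW.
Qed.

Lemma universal_streamP (w : seq bool) : exists i : nat, forall k,
  (k < size w)%N -> universal_stream (i + k)%N%:Z = nth false w k.
Proof.
pose j := pickle w; exists (size (word_list j)).+1 => k kw.
have E : word_list j.+1 = word_list j ++ false :: w.
  by rewrite word_listS /j pickleK.
rewrite (universal_streamE j.+1); last by rewrite E size_cat /=; lia.
by rewrite E nth_cat addSnnS ltnNge leq_addr /= addKn.
Qed.

Definition stream_at (i : int) : nat -> bool := fun k => universal_stream (i + k%:Z).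

Lemma stream_atP n (x : nat -> bool) : exists i, forall k, (k < n)%N ->
  stream_at i k = x k.
Proof.
have [i hi] := universal_streamP (mkseq x n); exists i%:Z => k kn.
by rewrite /stream_at -PoszD hi ?size_mkseq// nth_mkseq.
Qed.

Lemma iter_behead_stream_at i k : iter k behead_stream (stream_at i) = stream_at (i + k%:Z).
Proof.
apply/funext => l; rewrite iter_beheadE /stream_at; congr universal_stream; lia.
Qed.

(** * Integrals of functions of finitely many positive coordinates *)

Section LocalIntegrals.
Context {R : realType}.
Variable nu : probability Sigma2 R.
Implicit Types f g : (nat -> bool) -> R.

Local Notation stream x := (fun k : nat => (x : Sigma2) k.+1%:Z).

Let wordify m f : local_upto m f -> forall x : Sigma2,
  f (stream x) = f (nth false (first_letters m x)).
Proof. by move=> fm x; apply: fm => k km; rewrite nth_mkseq. Qed.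

Lemma local_integrable m f : local_upto m f ->
  nu.-integrable setT (EFin \o (fun x : Sigma2 => f (stream x))).
Proof.
move=> fm; rewrite (_ : (fun x : Sigma2 => f (stream x)) =
  fun x => f (nth false (first_letters m x))); last exact/funext/wordify.
exact: (word_fun_integrable nu m (fun w => f (nth false w))).
Qed.

Lemma local_Rintegral_le m n f g : local_upto m f -> local_upto n g ->
  (forall x, f x <= g x) ->
  \int[nu]_x f (stream x) <= \int[nu]_x g (stream x).
Proof.
move=> fm gn fg; apply: le_Rintegral => //.
- exact: local_integrable fm.
- exact: local_integrable gn.
Qed.

Lemma local_Rintegral_lin m n a f g : local_upto m f -> local_upto n g ->
  \int[nu]_x (a * f (stream x) + g (stream x)) =
  a * \int[nu]_x f (stream x) + \int[nu]_x g (stream x).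
Proof.
move=> fm gn.
rewrite (@RintegralD _ _ _ nu setT (fun x : Sigma2 => a * f (stream x)))//.
- by rewrite RintegralZl//; exact: local_integrable fm.
- exact: (local_integrable m (fun x => a * f x) (local_upto_op1 _ _ _ fm)).
- exact: local_integrable gn.
Qed.

Lemma local_Rintegral_cst (c : R) : \int[nu]_x c = c.
Proof.
rewrite Rintegral_cst// -[RHS]mulr1; congr (_ * _).
exact: (congr1 fine (probability_setT nu)).
Qed.

Lemma Rintegral_word_dev p w j : invariant_measure sigma nu ->
  \int[nu]_x word_dev p w (iter j behead_stream (stream x)) =
  fine (nu [set x : Sigma2 | first_letters (size w) x = w]) - word_weight p w.
Proof.
move=> inv; set A := [set x | _].
pose F x : R := (mkseq (iter j behead_stream x) (size w) == w)%:R.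
have lF : local_upto (j + size w) F.
  exact: (local_upto_iter _ j _ (local_upto_mkseq (fun u => (u == w)%:R) (size w))).
have := local_Rintegral_lin (j + size w) 0 1 F (fun=> - word_weight p w) lF (fun _ _ _ => erefl).
rewrite local_Rintegral_cst mul1r => E.
rewrite (eq_Rintegral nu (g := fun x : Sigma2 => 1 * F (stream x) + - word_weight p w)); last first.
  by move=> x _; rewrite mul1r.
rewrite E; congr (_ + _).
rewrite (eq_Rintegral nu (g := \1_(iter j sigma @^-1` A))); last first.
  move=> x _; rewrite /F indicE.
  have -> : mkseq (iter j behead_stream (stream x)) (size w) =
      first_letters (size w) (iter j sigma x).
    by rewrite first_letters_iter_sigma.
  case: eqP => h; first by rewrite mem_set.
  by rewrite memNset.
have fA : finitary A by exact: (finitary_word_set (size w) [set u | u = w]).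
have mA := finitary_measurable _ (finitary_iter_sigma j A fA).
rewrite /Rintegral.
have -> := @integral_indic _ _ _ nu setT measurableT _ mA.
by rewrite setIT; exact: (congr1 fine (invariant_iter nu j A inv fA)).
Qed.

Lemma Rintegral_birkhoff_word_dev p w n : invariant_measure sigma nu ->
  \int[nu]_x birkhoff n (word_dev p w) (stream x) = n%:R *
  (fine (nu [set x : Sigma2 | first_letters (size w) x = w]) - word_weight p w).
Proof.
move=> inv; elim: n => [|n IH].
  rewrite mul0r -[RHS](local_Rintegral_cst 0).
  by apply: eq_Rintegral => x _; rewrite /birkhoff big_ord0.
rewrite (eq_Rintegral nu (g := fun x : Sigma2 => 1 * birkhoff n (word_dev p w) (stream x) +
    word_dev p w (iter n behead_stream (stream x)))); last first.
  by move=> x _; rewrite mul1r birkhoffSr.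
rewrite (local_Rintegral_lin (n + size w) (n + size w) 1 _
    (fun x => word_dev p w (iter n behead_stream x))).
- by rewrite IH Rintegral_word_dev// -natr1; ring.
- exact/local_upto_birkhoff/local_word_dev.
- exact/local_upto_iter/local_word_dev.
Qed.

End LocalIntegrals.

Section GrowthRates.
Context {R : realType}.
Variable p : R.
Hypotheses (p_ge0 : 0 <= p) (p_le1 : p <= 1).

Definition log_coefficient (b : bool) (i : int) : R :=
  - potential p (stream_at i) - (b != universal_stream i)%:R.

Definition path_sum (w : seq bool) (i : int) : R :=
  \sum_(k < size w) log_coefficient (nth false w k) (i + k%:Z).

Definition mismatches n (x y : nat -> bool) : R := \sum_(k < n) (x k != y k)%:R.

Lemma path_sum_mkseq x n i : path_sum (mkseq x n) i =
  - birkhoff n (potential p) (stream_at i) - mismatches n x (stream_at i).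
Proof.
rewrite /path_sum size_mkseq /birkhoff /mismatches -sumrN -sumrB.
by apply: eq_bigr => k _; rewrite nth_mkseq// iter_behead_stream_at.
Qed.

Lemma mismatches_ge0 n x y : 0 <= mismatches n x y.
Proof. by apply: sumr_ge0 => k _; exact: ler0n. Qed.

Lemma mismatches_shift n l x y :
  \sum_(j < n) (x (j + l)%N != y (j + l)%N)%:R <= mismatches n x y + l%:R.
Proof.
rewrite /mismatches.
have H : \sum_(k < n + l) (x k != y k)%:R <= \sum_(k < n) (x k != y k)%:R + l%:R :> R.
  rewrite big_split_ord /= lerD2l -[leRHS]mulr1 mulr_natl -[in leRHS](card_ord l) -sumr_const.
  by apply: ler_sum => k _; case: (_ != _).
apply: le_trans H; rewrite addnC big_split_ord /= -[leLHS]add0r.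
apply: lerD; first by apply: sumr_ge0.
by apply: ler_sum => j _; rewrite addnC.
Qed.

(** The terms at [j] differ only if the sequences disagree on one of the [size u] letters read
    there, and each mismatch is read from at most [size u] places. The extra [size u] pays for
    letters beyond [n]. *)
Lemma birkhoff_word_dev_mismatches u n x y :
  `|birkhoff n (word_dev p u) x - birkhoff n (word_dev p u) y| <=
  (size u)%:R * (mismatches n x y + (size u)%:R).
Proof.
rewrite /birkhoff -sumrB; apply: le_trans (ler_norm_sum _ _ _) _.
apply: (@le_trans _ _
    (\sum_(j < n) \sum_(l < size u) (x (j + l)%N != y (j + l)%N)%:R)).
  apply: ler_sum => j _.
  have [/forallP E|/forallPn [l xy]] := boolP [forall l : 'I_(size u), x (j + l)%N == y (j + l)%N].
    rewrite (local_word_dev p u (iter j behead_stream x) (iter j behead_stream y)).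
      by rewrite subrr normr0 sumr_ge0.
    by move=> k ku; rewrite !iter_beheadE; exact/eqP/(E (Ordinal ku)).
  rewrite (bigD1 l)//= xy; apply: (@le_trans _ _ 1); last by rewrite lerDl sumr_ge0.
  rewrite /word_dev opprB addrA subrK.
  by do 2 case: eqP => _ /=; rewrite ?subrr ?normr0 ?subr0 ?normr1// sub0r normrN1.
rewrite exchange_big /=.
apply: (@le_trans _ _ (\sum_(l < size u) (mismatches n x y + (size u)%:R))).
  apply: ler_sum => l _; apply: le_trans (mismatches_shift n l x y) _.
  by rewrite lerD2l ler_nat ltnW.
by rewrite sumr_const card_ord [leRHS]mulr_natl.
Qed.

(** Stands for the logarithm of the norm of a word operator, characterised as the supremum of the
    path sums. *)
Variable lam : seq bool -> R.
Hypothesis lam_ge : forall w i, path_sum w i <= lam w.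
Hypothesis lam_le : forall w B, (forall i, path_sum w i <= B) -> lam w <= B.

Lemma growth_le eps : 0 < eps -> exists C, forall w,
  lam w <= C + (size w)%:R * eps.
Proof.
move=> eps0; have [C hC] := birkhoff_potential_ge p p_ge0 p_le1 eps eps0.
exists C => w; apply: lam_le => i.
rewrite -[w in path_sum w](mkseq_nth false) path_sum_mkseq.
have := hC (size w) (stream_at i).
have := mismatches_ge0 (size w) (nth false w) (stream_at i).
lra.
Qed.

(** Some window of the universal stream copies [n + m] letters of [x]: it has no mismatch, and the
    local majorant has the same Birkhoff sum there as at [x]. *)
Lemma growth_ge_birkhoff m f n x : local_upto m f ->
  (forall y, potential p y <= f y) ->
  - birkhoff n f x <= lam (mkseq x n).
Proof.
move=> fm hf; have [i hi] := stream_atP (n + m) x.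
apply: le_trans (lam_ge _ i); rewrite path_sum_mkseq.
have -> : mismatches n x (stream_at i) = 0.
  apply: big1 => k _; rewrite hi ?eqxx//.
  by rewrite (leq_trans (ltn_ord k))// leq_addr.
rewrite subr0 lerN2 (le_trans (le_birkhoff n _ f _ hf))//.
by rewrite (local_upto_birkhoff m n f fm _ x hi).
Qed.

Local Notation stream x := (fun k : nat => (x : Sigma2) k.+1%:Z).

Lemma growth_bernoulli_ge (mu : probability Sigma2 R) eps n :
  (forall (J : seq int) (v : int -> bool), uniq J ->
    mu [set x | forall i, i \in J -> x i = v i] =
    (\prod_(i <- J) bernoulli_weight p (v i))%:E) ->
  0 < eps -> (0 < n)%N ->
  - (n%:R * eps) <= \int[mu]_x lam (first_letters n x).
Proof.
move=> mu_box eps0 n0.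
have [m [f [c [fm hf fc ce]]]] := potential_majorant p p_ge0 p_le1 eps eps0.
have fn := local_upto_birkhoff m n f fm.
(* A Birkhoff sum is [n] times an ergodic average, whose mean is that of [f]. *)
have Sc : has_mean p (fun x => - birkhoff n f x) (- (n%:R * c)).
  have := has_mean_lin p (- n%:R) _ _ _ _ (has_mean_ergodic_avg p p_ge0 p_le1 n f c n0 fc)
    (has_mean_cst p 0).
  rewrite addr0 mulNr; congr (has_mean p _ _); apply/funext => x.
  by rewrite /ergodic_avg addr0 mulNr mulVKf// pnatr_eq0 -lt0n.
have E := bernoulli_Rintegral p mu p_ge0 p_le1 mu_box _ _ _ (local_upto_op1 -%R _ _ fn) Sc.
apply: (@le_trans _ _ (- (n%:R * c))); first by rewrite lerN2 ler_wpM2l.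
rewrite -E.
apply: (local_Rintegral_le mu _ n _ (fun x => lam (mkseq x n)) (local_upto_op1 -%R _ _ fn)).
  exact: local_upto_mkseq.
by move=> x; exact: growth_ge_birkhoff fm hf.
Qed.

(* Small multiples [a] of the deviation are used so that the cost of replacing
   [x] by a window of the universal stream is absorbed by the mismatches. *)
Lemma growth_word_dev_le u a c : 0 < c -> 2 * `|a| * (size u)%:R <= 1 ->
  exists b C, [/\ 0 < b, b <= 1 & forall n x, lam (mkseq x n) <=
    - (b * (2 * a * birkhoff n (word_dev p u) x - n%:R * a ^+ 2 - n%:R * c)) + C].
Proof.
move=> c0 ha; have [b [C [b0 b1 hb]]] := birkhoff_potential_dev p p_ge0 p_le1 u a c c0.
exists b, (C + (size u)%:R); split=> // n x; apply: lam_le => i.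
rewrite path_sum_mkseq; set y := stream_at i.
have := hb n y; have := birkhoff_word_dev_mismatches u n x y.
have := mismatches_ge0 n x y.
set M := mismatches n x y; set Sx := birkhoff n _ x; set Sy := birkhoff n _ y.
set s : R := (size u)%:R in ha *; have s0 : 0 <= s by exact: ler0n.
move=> M0 hS hy.
have : b * (2 * a) * (Sx - Sy) <= M + s.
  apply: le_trans (ler_norm _) _; rewrite normrM.
  have -> : `|b * (2 * a)| = b * (2 * `|a|).
    by rewrite !normrM (gtr0_norm b0) ger0_norm.
  apply: (@le_trans _ _ (b * (2 * `|a|) * (s * (M + s)))).
    by rewrite ler_wpM2l// !mulr_ge0// ltW.
  rewrite -[leRHS]mul1r mulrA ler_wpM2r ?addr_ge0// -mulrA mulr_ile1//.
  - exact: ltW.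
  - by rewrite !mulr_ge0.
rewrite mulrBr; move: hy; rewrite !mulrBr !mulrA; lra.
Qed.

(** By invariance the mean deviation is [theta] per letter, so [growth_word_dev_le] integrates to a
    growth of at most [- b * (2 * a * theta - a ^+ 2 - c)] per letter. *)
Lemma growth_other_measure (nu : probability Sigma2 R) u :
  invariant_measure sigma nu ->
  fine (nu [set x : Sigma2 | first_letters (size u) x = u]) != word_weight p u ->
  exists delta C, 0 < delta /\ forall n,
    \int[nu]_x lam (first_letters n x) <= C - n%:R * delta.
Proof.
move=> inv; set nuu := fine _; rewrite -subr_eq0; set theta := nuu - _ => th0.
pose m1 : R := (size u).+1%:R; have m1_gt0 : 0 < m1 by rewrite ltr0n.
have th1 : `|theta| <= 1.
  have h0 := word_weight_ge0 p p_ge0 p_le1 u; have h1 := word_weight_le1 p p_ge0 p_le1 u.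
  have n0 : 0 <= nuu by exact: fine_ge0.
  have n1 : nuu <= 1.
    rewrite -lee_fin fineK ?fin_num_measure//; last first.
      exact: (measurable_word_set (size u) [set v | v = u]).
    by apply: probability_le1; exact: (measurable_word_set (size u) [set v | v = u]).
  by rewrite /theta ler_norml; lra.
(* As [theta] is at most 1 in absolute value, the slope condition holds; [c] is such that
   [2 * a * theta - a ^+ 2 >= 2 * c], which leaves the rate [b * c]. *)
pose a := theta / (2 * m1); pose c := theta ^+ 2 / (4 * m1).
have c0 : 0 < c by rewrite divr_gt0 ?exprn_even_gt0// mulr_gt0.
have ha : 2 * `|a| * (size u)%:R <= 1.
  rewrite /a normrM normfV (gtr0_norm (mulr_gt0 _ m1_gt0))//.
  have -> : 2 * (`|theta| / (2 * m1)) * (size u)%:R = `|theta| * ((size u)%:R / m1).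
    by field; rewrite lt0r_neq0.
  by rewrite mulr_ile1// ?divr_ge0// ler_pdivrMr// mul1r ler_nat.
have [b [C [b0 b1 hb]]] := growth_word_dev_le u a c c0 ha.
exists (b * c), C; split; first exact: mulr_gt0.
move=> n.
have lw := local_upto_birkhoff _ n _ (local_word_dev p u).
pose q := b * (n%:R * a ^+ 2 + n%:R * c) + C.
have lr : local_upto (n + size u) (fun x => - (2 * a * b) * birkhoff n (word_dev p u) x + q).
  exact: (local_upto_op1 (fun t => - (2 * a * b) * t + q)).
have := local_Rintegral_le nu n _ (fun x => lam (mkseq x n)) _ (local_upto_mkseq lam n) lr.
rewrite (local_Rintegral_lin nu _ 0 _ _ (fun=> q) lw (fun _ _ _ => erefl)).
rewrite local_Rintegral_cst Rintegral_birkhoff_word_dev// -/nuu -/theta => H.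
apply: le_trans (H _) _.
  by move=> x; apply: le_trans (hb n x) _; rewrite /q; lra.
rewrite /q -subr_ge0.
have -> : C - n%:R * (b * c) - (- (2 * a * b) * (n%:R * theta) +
    (b * (n%:R * a ^+ 2 + n%:R * c) + C)) =
    n%:R * b * (2 * a * theta - a ^+ 2 - 2 * c) by ring.
rewrite !mulr_ge0//; first exact: ltW.
have -> : 2 * a * theta - a ^+ 2 - 2 * c =
    theta ^+ 2 / (2 * m1) * (1 - (2 * m1)^-1).
  by rewrite /a /c; field; rewrite lt0r_neq0.
apply: mulr_ge0; first by rewrite divr_ge0 ?sqr_ge0// mulr_ge0// ltW.
rewrite subr_ge0 invf_le1 ?mulr_gt0//.
have : 1 <= m1 by rewrite ler1n.
lra.
Qed.

End GrowthRates.

(** * Weighted shift operators *)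

Definition int_enum (k : nat) : int := if odd k then Negz k./2 else Posz k./2.

Lemma int_enum_inj : injective int_enum.
Proof.
move=> i j; rewrite /int_enum; have := odd_double_half i; have := odd_double_half j.
by case: (odd i); case: (odd j) => // h1 h2 [h]; rewrite -h1 -h2 h.
Qed.

Lemma int_enum_surj i : exists k, int_enum k = i.
Proof.
case: i => n; [exists n.*2|exists n.*2.+1]; rewrite /int_enum /=.
  by rewrite odd_double doubleK.
by rewrite odd_double /= uphalf_double.
Qed.

Section ShiftOperators.
Context {R : realType} {H : completeNormedModType R}.
Variables (ip : {dot H for idfun}) (e : int -> H).
Hypotheses (ipP : norm_from_dot ip) (eP : orthonormal_basis ip e).

Let ip_linear a x y z : ip (a *: x + y) z = a * ip x z + ip y z.
Proof. exact: linearPl. Qed.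

Let ipC x y : ip x y = ip y x.
Proof. by rewrite hermC expr0 mul1r. Qed.

Let ipD x y z : ip (x + y) z = ip x z + ip y z.
Proof. by have := ip_linear 1 x y z; rewrite scale1r mul1r. Qed.

Let ip0 z : ip 0 z = 0.
Proof. by have := ip_linear 1 0 0 z; rewrite scale1r mul1r addr0; lra. Qed.

Let ipZ a x z : ip (a *: x) z = a * ip x z.
Proof. by have := ip_linear a x 0 z; rewrite ip0 !addr0. Qed.

Let ip_sum (I : Type) (r : seq I) (F : I -> H) z :
  ip (\sum_(i <- r) F i) z = \sum_(i <- r) ip (F i) z.
Proof.
by elim: r => [|i r IH]; rewrite ?big_nil ?ip0// !big_cons ipD IH.
Qed.

Let ip_e i j : ip (e i) (e j) = (i == j)%:R.
Proof. by have [h _] := eP; exact: h. Qed.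

Lemma norm_basis i : `|e i| = 1.
Proof.
have := ipP (e i); rewrite ip_e eqxx -[X in _ = X](expr1n _ 2) => /eqP.
by rewrite eqrXn2// => /eqP.
Qed.

Lemma pythagoras (I : eqType) (r : seq I) (f : I -> int) (c : I -> R) :
  injective f -> uniq r ->
  `|\sum_(k <- r) c k *: e (f k)| ^+ 2 = \sum_(k <- r) c k ^+ 2.
Proof.
move=> finj ur; rewrite ipP ip_sum; apply: eq_big_seq => k kr.
rewrite ipZ ipC ip_sum (bigD1_seq k)//= ipZ ip_e eqxx mulr1.
rewrite big1 ?addr0 ?expr2// => j jk; rewrite ipZ ip_e.
by rewrite (inj_eq finj) (negbTE jk) mulr0.
Qed.

Lemma bessel x (r : seq nat) : uniq r ->
  \sum_(k <- r) ip x (e (int_enum k)) ^+ 2 <= `|x| ^+ 2.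
Proof.
move=> ur; pose c k := ip x (e (int_enum k)); pose s := \sum_(k <- r) c k *: e (int_enum k).
have h1 : ip s s = \sum_(k <- r) c k ^+ 2.
  by rewrite -ipP pythagoras//; exact: int_enum_inj.
have h2 : ip s x = \sum_(k <- r) c k ^+ 2.
  by rewrite ip_sum; apply: eq_bigr => k _; rewrite ipZ ipC.
have := sqr_ge0 `|(-1) *: s + x|; rewrite ipP ip_linear.
rewrite (ipC s) (ipC x) !ip_linear (ipC x s) h1 h2 -ipP; lra.
Qed.

Section Construction.
Variables (d : int) (a : int -> R) (B : R).
Hypothesis aB : forall i, `|a i| <= B.

Let B_ge0 : 0 <= B. Proof. exact: le_trans (aB 0). Qed.

Let term x k : H := (a (int_enum k) * ip x (e (int_enum k))) *: e (int_enum k + d).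

Let term_norm x (r : seq nat) : uniq r ->
  `|\sum_(k <- r) term x k| ^+ 2 <= B ^+ 2 * \sum_(k <- r) ip x (e (int_enum k)) ^+ 2.
Proof.
move=> ur; rewrite (pythagoras _ r (fun k => int_enum k + d))//; last first.
  by move=> i j /addIr /int_enum_inj.
rewrite mulr_sumr; apply: ler_sum => k _; rewrite exprMn ler_wpM2r ?sqr_ge0//.
by rewrite -real_normK ?num_real// lerXn2r ?nnegrE.
Qed.

Let term_cvg x : cvgn (series (term x)).
Proof.
pose q k := ip x (e (int_enum k)) ^+ 2.
have qc : cvgn (series q).
  apply: nondecreasing_is_cvgn.
    apply/nondecreasing_seqP => n; rewrite /series /= big_nat_recr//= lerDl.
    exact: sqr_ge0.
  exists (`|x| ^+ 2) => _ [n _ <-]; rewrite /series /=.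
  by apply: bessel; exact: iota_uniq.
apply/cauchy_cvgP/cauchy_seriesP => eps eps0.
move/cauchy_cvgP/cauchy_seriesP : qc.
(* [B] may be zero, so [B + 1] serves as divisor. *)
have D0 : 0 < (B + 1) ^+ 2 by rewrite exprn_gt0// ltr_wpDl.
move=> /(_ (eps ^+ 2 / (B + 1) ^+ 2)) []; first by rewrite divr_gt0// exprn_gt0.
move=> V hV sub; exists V => // mn Vmn; have := sub _ Vmn; rewrite /=.
set S := \sum_(_ <= k < _) q k.
have S0 : 0 <= S by apply: sumr_ge0 => k _; exact: sqr_ge0.
rewrite ger0_norm// ltr_pdivlMr// => hS.
rewrite -(@ltr_pXn2r _ 2)// ?nnegrE// ?(ltW eps0)//.
apply: le_lt_trans hS; apply: (le_trans (term_norm x _ (iota_uniq _ _))).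
rewrite mulrC -/S ler_wpM2l// lerXn2r ?nnegrE// ?lerDl//.
exact: addr_ge0.
Qed.

Let op x : H := limn (series (term x)).

Let term_lin b x y k : term (b *: x + y) k = b *: term x k + term y k.
Proof. by rewrite /term ip_linear mulrDr scalerDl scalerA mulrCA. Qed.

Let op_linear : linear op.
Proof.
move=> b x y; rewrite /op; apply: cvg_lim => //.
rewrite (_ : series (term (b *: x + y)) =
  fun n => b *: series (term x) n + series (term y) n); last first.
  apply/funext => n; rewrite /series /= scaler_sumr -big_split /=.
  by apply: eq_bigr => k _; rewrite term_lin.
apply: cvgD; last exact: term_cvg.
by apply: cvgZl_tmp; exact: term_cvg.
Qed.

(** The series of the images of the basis components converges by Bessel's inequality. A general [d]
    covers the shifts, their inverses ([d = -1]) and the comparison with word operators. *)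
Lemma shift_operator_exists : exists L : {linear H -> H},
  (forall x, `|L x| <= B * `|x|) /\ forall i, L (e i) = a i *: e (i + d).
Proof.
pose L : {linear H -> H} := HB.pack op (GRing.isLinear.Build _ _ _ _ op op_linear).
exists L; split.
  move=> x; rewrite [L x]/(op x) /op.
  rewrite -lim_norm; last exact: (term_cvg x).
  apply: limr_le; first by apply: is_cvg_norm; exact: term_cvg.
  apply: nearW => n.
  rewrite -(@ler_pXn2r _ 2)// ?nnegrE// ?mulr_ge0// exprMn.
  apply: le_trans (term_norm x _ (iota_uniq _ _)) _.
  by rewrite ler_wpM2l ?sqr_ge0// bessel// iota_uniq.
move=> i; rewrite [L _]/(op _) /op; have [k ki] := int_enum_surj i.
apply: cvg_lim => //; apply: cvg_near_cst; exists k.+1 => // n /= kn.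
rewrite /series /= (bigD1_seq k)/= ?iota_uniq//; last by rewrite mem_index_iota.
rewrite /term ki ip_e eqxx mulr1 big1 ?addr0// => j jk.
rewrite ip_e -ki (inj_eq int_enum_inj) eq_sym (negbTE jk) mulr0 scale0r.
by [].
Qed.

End Construction.

(** A predicate on bare functions, since [word_op] is not packed as a linear map. *)
Definition bounded_linear (f : H -> H) :=
  (forall b x y, f (b *: x + y) = b *: f x + f y) /\
  exists M, 0 <= M /\ forall x, `|f x| <= M * `|x|.

Lemma bounded_linear_comp f g :
  bounded_linear f -> bounded_linear g -> bounded_linear (f \o g).
Proof.
move=> [fl [M [M0 hM]]] [gl [N [N0 hN]]]; split=> [b x y|] /=; first by rewrite gl fl.
exists (M * N); split; first exact: mulr_ge0.
by move=> x; apply: (le_trans (hM _)); rewrite -mulrA ler_wpM2l.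
Qed.

Lemma bounded_linear_id : bounded_linear id.
Proof. by split=> //; exists 1; split=> // x; rewrite mul1r. Qed.

Lemma bounded_linear_operator (L : {linear H -> H}) :
  bounded_operator L -> bounded_linear L.
Proof.
move=> [M hM]; split; first by move=> b x y; rewrite linearP.
exists `|M|; split=> // x; apply: (le_trans (hM x)).
by rewrite ler_wpM2r// ler_norm.
Qed.

Lemma bounded_linear_ext f g : bounded_linear f -> bounded_linear g ->
  (forall i, f (e i) = g (e i)) -> f =1 g.
Proof.
move=> [fl [M [M0 hM]]] [gl [N [N0 hN]]] fg x.
have [_ dense] := eP.
have f0 : f 0 = 0 by have := fl (-1) 0 0; rewrite scaler0 addr0 scaleN1r addNr.
have g0 : g 0 = 0 by have := gl (-1) 0 0; rewrite scaler0 addr0 scaleN1r addNr.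
have fg_span y : lin_span e y -> f y = g y.
  move=> [s [c ->]]; elim: s => [|i s IH]; first by rewrite big_nil f0 g0.
  by rewrite big_cons fl gl fg IH.
apply/eqP; rewrite -subr_eq0 -normr_le0; apply/ler_addgt0Pl => eps eps0.
rewrite addr0.
have K0 : 0 < M + N + 1 by rewrite ltr_wpDl// addr_ge0.
have : closure (lin_span e) x by rewrite dense.
move=> /(_ (ball x (eps / (M + N + 1)))) [|y [ey yx]].
  by apply: nbhsx_ballx; rewrite divr_gt0.
have xy : `|x - y| < eps / (M + N + 1) by rewrite -ball_normE in yx.
have -> : f x - g x = f (1 *: (x - y) + y) - g (1 *: (x - y) + y).
  by rewrite scale1r subrK.
rewrite fl gl (fg_span y ey) !scale1r opprD addrACA subrr addr0.
apply: le_trans (ler_normB _ _) _.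
apply: (le_trans (lerD (hM _) (hN _))); rewrite -mulrDl.
move: xy; rewrite ltr_pdivlMr// => /ltW; apply: le_trans.
by rewrite mulrC ler_wpM2l// lerDl.
Qed.

Lemma op_norm_ge f d (a : int -> R) i : bounded_linear f ->
  (forall i, f (e i) = a i *: e (i + d)) -> `|a i| <= op_norm f.
Proof.
move=> [_ [M [M0 hM]]] fe; apply: sup_ubound.
  exists M => _ [x /= x1 <-]; apply: le_trans (hM x) _.
  by rewrite -[leRHS]mulr1 ler_wpM2l.
exists (e i); first by rewrite /= norm_basis.
by rewrite fe normrZ norm_basis mulr1.
Qed.

(** [f] agrees on the basis, hence everywhere, with the operator of [shift_operator_exists], which
    is bounded by [B]. Together with [op_norm_ge] this identifies the norm as the supremum of the
    absolute coefficients. *)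
Lemma op_norm_le f d (a : int -> R) B : bounded_linear f ->
  (forall i, f (e i) = a i *: e (i + d)) -> (forall i, `|a i| <= B) ->
  op_norm f <= B.
Proof.
move=> fb fe aB; have [L [LB Le]] := shift_operator_exists d a B aB.
have B0 : 0 <= B by exact: le_trans (aB 0).
have fL : f =1 L.
  apply: bounded_linear_ext => // [|i]; last by rewrite fe Le.
  by apply: bounded_linear_operator; exists B.
apply: ge_sup; first by exists `|f 0|, 0 => //=; rewrite normr0 ler01.
move=> _ [x /= x1 <-]; rewrite fL; apply: le_trans (LB x) _.
by rewrite -[leRHS]mulr1 ler_wpM2l.
Qed.

(** The inverse is the backward shift with reciprocal coefficients; the bound on [c] controls
    both. *)
Lemma positive_shift_exists (c : int -> R) B : (forall i, `|c i| <= B) ->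
  exists L : {linear H -> H}, [/\ positive_invertible_shift e L,
    bounded_linear L & forall i, L (e i) = expR (c i) *: e (i + 1)].
Proof.
move=> cB.
have h1 i : `|expR (c i)| <= expR B.
  by rewrite ger0_norm ?expR_ge0// ler_expR (le_trans (ler_norm _)).
have h2 i : `|expR (- c (i - 1))| <= expR B.
  by rewrite ger0_norm ?expR_ge0// ler_expR (le_trans (ler_norm _))// normrN.
have [L [LB Le]] := shift_operator_exists 1 _ _ h1.
have [K [KB Ke]] := shift_operator_exists (-1) _ _ h2.
have bL : bounded_operator L by exists (expR B).
have bK : bounded_operator K by exists (expR B).
have lL := bounded_linear_operator L bL; have lK := bounded_linear_operator K bK.
exists L; split=> //.
exists (fun i => expR (c i)); split=> //; first by move=> i; exact: expR_gt0.
exists K; split=> //.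
  apply: (bounded_linear_ext (K \o L) id) => //; first exact: bounded_linear_comp.
    exact: bounded_linear_id.
  by move=> i; rewrite /= Le linearZ /= Ke addrK scalerA -expRD subrr expR0 scale1r.
apply: (bounded_linear_ext (L \o K) id) => //; first exact: bounded_linear_comp.
  exact: bounded_linear_id.
by move=> i; rewrite /= Ke linearZ /= Le subrK scalerA -expRD addNr expR0 scale1r.
Qed.

Lemma word_op_bounded_linear (L : {linear H -> H} * {linear H -> H}) w :
  (forall b, bounded_linear (pick_op L b)) -> bounded_linear (word_op L w).
Proof.
move=> bL; elim: w => [|b w IH]; first exact: bounded_linear_id.
exact: (bounded_linear_comp (word_op L w) (pick_op L b)).
Qed.

Lemma word_op_basis (L : {linear H -> H} * {linear H -> H})
    (c : bool -> int -> R) w i :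
  (forall b i, pick_op L b (e i) = expR (c b i) *: e (i + 1)) ->
  (forall b, bounded_linear (pick_op L b)) ->
  word_op L w (e i) =
  expR (\sum_(k < size w) c (nth false w k) (i + k%:Z)) *: e (i + (size w)%:Z).
Proof.
move=> Le bL; elim: w i => [|b w IH] i.
  by rewrite big_ord0 expR0 scale1r addr0.
have [lin _] := word_op_bounded_linear L w bL.
have w0 : word_op L w 0 = 0.
  by have := lin (-1) 0 0; rewrite scaler0 addr0 scaleN1r addNr.
have := lin (expR (c b i)) (e (i + 1)) 0; rewrite w0 !addr0 => E.
transitivity (word_op L w (pick_op L b (e i))) => //.
rewrite Le E IH scalerA -expRD big_ord_recl /= addr0; congr (expR (_ + _) *: e _).
  by apply: eq_bigr => k _; rewrite /bump leq0n add1n /= intS addrA.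
by rewrite intS addrA.
Qed.

End ShiftOperators.

(** * Spectral radius and maximising measures of the constructed pair *)

Section Assembly.
Context {R : realType} {H : completeNormedModType R}.
Variables (ip : {dot H for idfun}) (e : int -> H).
Hypotheses (ipP : norm_from_dot ip) (eP : orthonormal_basis ip e).
Variable p : R.
Hypotheses (p_ge0 : 0 <= p) (p_le1 : p <= 1).

Lemma log_coefficient_bounded b i : `|log_coefficient p b i| <= 3.
Proof.
have := potential_norm p p_ge0 p_le1 (stream_at i).
by rewrite /log_coefficient !ler_norml; case: (_ != _) => /=; lra.
Qed.

Lemma shift_pair_exists : exists L : {linear H -> H} * {linear H -> H},
  [/\ shift_pairs e L, forall w, 0 < op_norm (word_op L w),
    forall w i, path_sum p w i <= ln (op_norm (word_op L w)) &
    forall w B, (forall i, path_sum p w i <= B) -> ln (op_norm (word_op L w)) <= B].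
Proof.
have [L0 [p0 b0 e0]] := positive_shift_exists _ _ ipP eP _ _ (log_coefficient_bounded false).
have [L1 [p1 b1 e1]] := positive_shift_exists _ _ ipP eP _ _ (log_coefficient_bounded true).
pose L := (L0, L1); have bL b : bounded_linear (pick_op L b) by case: b.
have wE w i : word_op L w (e i) = expR (path_sum p w i) *: e (i + (size w)%:Z).
  by apply: word_op_basis => //; case.
have bw w := word_op_bounded_linear L w bL.
have ge w i : expR (path_sum p w i) <= op_norm (word_op L w).
  have := op_norm_ge ip e ipP eP _ (size w)%:Z _ i (bw w) (wE w).
  by rewrite ger0_norm ?expR_ge0.
have gt0 w : 0 < op_norm (word_op L w).
  by apply: lt_le_trans (ge w 0); exact: expR_gt0.
exists L; split=> // [w i|w B wB].
  by rewrite -[leLHS]expRK ler_ln ?posrE ?expR_gt0.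
rewrite -[leRHS]expRK ler_ln ?posrE ?expR_gt0//.
apply: (op_norm_le ip e ipP eP _ (size w)%:Z _ _ (bw w) (wE w)) => i.
by rewrite ger0_norm ?expR_ge0// ler_expR.
Qed.

Variable L : {linear H -> H} * {linear H -> H}.
Let lam w : R := ln (op_norm (word_op L w)).
Hypothesis op_norm_gt0 : forall w, 0 < op_norm (word_op L w).

Lemma joint_spectral_radius1 :
  (forall eps, 0 < eps -> exists C, forall w, lam w <= C + (size w)%:R * eps) ->
  (forall eps n, 0 < eps -> (0 < n)%N ->
    exists w : n.-tuple bool, - (n%:R * eps) <= lam w) ->
  joint_spectral_radius L = 1.
Proof.
move=> hle hge; apply: cvg_lim => //; apply/cvgrPdist_le => eps eps0.
have : expR x @[x --> (0 : R)] --> (1 : R) by rewrite -expR0; exact: continuous_expR.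
move=> /cvgrPdist_le/(_ _ eps0)/nbhs_ballP[d /= d0 hd].
have hd' t : `|t| < d -> `|1 - expR t| <= eps.
  by move=> td; apply: hd; rewrite -ball_normE /= sub0r normrN.
have d2 : 0 < d / 4 by rewrite divr_gt0.
have [C hC] := hle _ d2.
have [N hN] : exists N : nat, `|C| / (d / 4) < N%:R.
  by exists (Num.truncn (`|C| / (d / 4))).+1; exact: truncnS_gt.
exists N.+1 => // n /= Nn.
have n0 : 0 < n%:R :> R by rewrite ltr0n; lia.
have nC : `|C| < n%:R * (d / 4).
  rewrite -ltr_pdivrMr//; apply: lt_le_trans hN _.
  by rewrite ler_nat; lia.
have pE (w : seq bool) : op_norm (word_op L w) `^ n%:R^-1 = expR (lam w / n%:R).
  by rewrite /powR gt_eqF// mulrC.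
set S := (X in sup X).
have ub : ubound S (expR (d / 2)).
  move=> _ [w _ <-]; rewrite pE ler_expR ler_pdivrMr//.
  have := hC w; rewrite size_tuple; have := ler_norm C; lra.
have [w0 hw0] := hge _ n d2 ltac:(by lia).
have wS : S (expR (lam w0 / n%:R)) by exists w0 => //; rewrite pE.
have h1 : sup S <= expR (d / 2) by apply: ge_sup => //; exists (expR (lam w0 / n%:R)).
have h2 : expR (- (d / 2)) <= sup S.
  apply: (@le_trans _ _ (expR (lam w0 / n%:R))).
    by rewrite ler_expR ler_pdivlMr//; have := mulr_gt0 n0 d0; lra.
  by apply: sup_ubound => //; exists (expR (d / 2)).
have := hd' (d / 2); have := hd' (- (d / 2)).
rewrite normrN gtr0_norm ?divr_gt0//.
have -> : d / 2 < d by lra.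
move=> /(_ isT) + /(_ isT); rewrite !ler_norml; lra.
Qed.

Hypothesis lam_ge : forall w i, path_sum p w i <= lam w.
Hypothesis lam_le : forall w B, (forall i, path_sum p w i <= B) -> lam w <= B.
Variable mu : probability Sigma2 R.
Hypothesis mu_box : forall (J : seq int) (v : int -> bool), uniq J ->
  mu [set x | forall i, i \in J -> x i = v i] =
  (\prod_(i <- J) bernoulli_weight p (v i))%:E.

Let growth_integral_le (nu : probability Sigma2 R) n (B : R) :
  (forall w : n.-tuple bool, lam w <= B) ->
  \int[nu]_x lam (first_letters n x) <= B.
Proof.
move=> hB; rewrite -[leRHS](local_Rintegral_cst nu).
apply: (local_Rintegral_le nu n 0 (fun x => lam (mkseq x n)) (fun=> B)) => //.
  exact: local_upto_mkseq.
move=> x; have sz : size (mkseq x n) == n by rewrite size_mkseq.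
exact: (hB (Tuple sz)).
Qed.

(** The lower bound is by averaging: if every word of length [n] had logarithmic norm below
    [- n * eps], the [mu]-average would be too low for [growth_bernoulli_ge]. *)
Lemma bernoulli_spectral_radius : joint_spectral_radius L = 1.
Proof.
apply: joint_spectral_radius1.
  by move=> eps eps0; exact: (growth_le p p_ge0 p_le1 lam lam_le).
move=> eps n eps0 n0; apply: contrapT => /forallNP hw.
have e2 : 0 < eps / 2 by rewrite divr_gt0.
have := growth_bernoulli_ge p p_ge0 p_le1 lam lam_ge mu _ n mu_box e2 n0.
apply/negP; rewrite -ltNge.
apply: (@le_lt_trans _ _ (- (n%:R * eps))).
  by apply: growth_integral_le => w; rewrite leNgt; apply/negP => /ltW /hw.
by rewrite ltrN2 ltr_pM2l ?ltr0n//; lra.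
Qed.

Lemma bernoulli_maximising : maximising_measure L mu.
Proof.
split; first exact: (bernoulli_invariant p mu mu_box).
rewrite bernoulli_spectral_radius ln1; apply/cvgrPdist_le => eps eps0.
have e2 : 0 < eps / 2 by rewrite divr_gt0.
have [C hC] := growth_le p p_ge0 p_le1 lam lam_le _ e2.
have [N hN] : exists N : nat, `|C| / (eps / 2) < N%:R.
  by exists (Num.truncn (`|C| / (eps / 2))).+1; exact: truncnS_gt.
exists N.+1 => // n /= Nn.
have n0 : 0 < n%:R :> R by rewrite ltr0n; lia.
have nC : `|C| < n%:R * (eps / 2).
  rewrite -ltr_pdivrMr//; apply: lt_le_trans hN _.
  by rewrite ler_nat; lia.
rewrite sub0r normrN normrM gtr0_norm ?invr_gt0// ler_pdivrMl//.
rewrite ler_norml; apply/andP; split.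
  by apply: (growth_bernoulli_ge p p_ge0 p_le1 lam lam_ge mu _ n mu_box eps0); lia.
apply: growth_integral_le => w; apply: (le_trans (hC w)); rewrite size_tuple.
have := ler_norm C; lra.
Qed.

(** A maximising measure has growth rate 0, which [growth_other_measure] excludes once a single word
    probability differs; word probabilities determine an invariant measure. *)
Lemma bernoulli_maximising_unique (nu : probability Sigma2 R) :
  maximising_measure L nu -> forall A, measurable A -> nu A = mu A.
Proof.
move=> [inv]; rewrite bernoulli_spectral_radius ln1 => lim0.
apply: invariant_measure_eq => //; first exact: (bernoulli_invariant p mu mu_box).
move=> w; rewrite (bernoulli_word p mu mu_box).
have mw : measurable [set y : Sigma2 | first_letters (size w) y = w].
  exact: (measurable_word_set (size w) [set u | u = w]).
rewrite -[LHS]fineK ?fin_num_measure//; congr (_%:E).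
apply/eqP; apply: contrapT => /negP nuw.
have [d [C [d0 hC]]] := growth_other_measure p p_ge0 p_le1 lam lam_le nu w inv nuw.
have d2 : 0 < d / 2 by rewrite divr_gt0.
move/cvgrPdist_lt : lim0 => /(_ _ d2)[N _ hN].
have [M hM] : exists M : nat, `|C| / (d / 2) < M%:R.
  by exists (Num.truncn (`|C| / (d / 2))).+1; exact: truncnS_gt.
pose n := (N + M).+1.
have n0 : 0 < n%:R :> R by rewrite ltr0n.
have nC : `|C| < n%:R * (d / 2).
  rewrite -ltr_pdivrMr//; apply: lt_le_trans hM _.
  by rewrite ler_nat /n; lia.
have /= := hN n ltac:(by rewrite /n /=; lia).
rewrite sub0r normrN normrM gtr0_norm ?invr_gt0// ltr_pdivrMl//.
apply/negP; rewrite -leNgt ler_normr; apply/orP; right.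
rewrite lerNr; apply: (le_trans (hC n)).
have := ler_norm C; lra.
Qed.

End Assembly.

(** * Entropy *)

Section FineProbability.
Context {d} {T : measurableType d} {R : realType}.
Variable mu : probability T R.

Local Notation Pr A := (fine (mu A)).

Lemma fine_prob_ge0 A : 0 <= Pr A.
Proof. exact: fine_ge0. Qed.

Lemma fine_prob_le (A B : set T) : measurable A -> measurable B -> A `<=` B ->
  Pr A <= Pr B.
Proof.
by move=> mA mB AB; rewrite fine_le ?fin_num_measure// le_measure ?inE.
Qed.

Lemma fine_probU (A B : set T) : measurable A -> measurable B ->
  Pr (A `|` B) <= Pr A + Pr B.
Proof.
move=> mA mB; rewrite -fineD ?fin_num_measure// fine_le ?fin_num_measure//.
- exact: measurableU.
- by rewrite fin_numD !fin_num_measure.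
- exact: measureU2.
Qed.

Lemma fine_prob_bigcup (I : finType) (F : I -> set T) :
  (forall i, measurable (F i)) -> Pr (\bigcup_i F i) <= \sum_i Pr (F i).
Proof.
move=> mF; have -> : \bigcup_i F i = \big[setU/set0]_(i : I) F i.
  by rewrite -bigcup_seq; apply/seteqP; split=> x [i _ Fx]; exists i => //=;
    rewrite mem_index_enum.
elim: (index_enum I) => [|i r IH]; first by rewrite !big_nil measure0.
rewrite !big_cons; apply: (le_trans (fine_probU _ _ _ _)) => //.
  by apply: bigsetU_measurable => *; exact: mF.
by rewrite lerD2l.
Qed.

Lemma fine_probT : Pr setT = 1.
Proof. exact: (congr1 fine (probability_setT mu)). Qed.

Definition measurable_partition (I : finType) (C : I -> set T) :=
  [/\ forall i, measurable (C i), trivIset setT C & \bigcup_i C i = setT].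

Lemma fine_prob_partition (I : finType) (C : I -> set T) (B : set T) :
  measurable_partition I C -> measurable B -> Pr B = \sum_i Pr (B `&` C i).
Proof.
move=> [mC tC CT] mB.
have -> : B = \bigcup_i (B `&` C i) by rewrite -setI_bigcupr CT setIT.
rewrite measure_finType_bigcup; last 2 first.
- by move=> i; exact: measurableI.
- by move=> i j _ _ [x [[_ ?] [_ ?]]]; apply: tC => //; exists x.
rewrite -sum_fine; last by move=> i _; rewrite fin_num_measure//; exact: measurableI.
by apply: eq_bigr => i _; rewrite -setI_bigcupr CT setIT.
Qed.

(** Apply [ln x <= x - 1] at [x = q / b]; then [a * (q / b) <= q] because [a <= b]. *)
Lemma gibbs_term (a b q : R) : 0 <= a -> a <= b -> 0 <= q -> (q = 0 -> a = 0) ->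
  a * (ln q - ln b) <= q - a.
Proof.
move=> a0 ab q0 qa; have [->|an0] := eqVneq a 0; first by rewrite mul0r subr0.
have ap : 0 < a by rewrite lt_neqAle eq_sym an0.
have bp : 0 < b by exact: lt_le_trans ab.
have qp : 0 < q.
  by rewrite lt_neqAle q0 andbT eq_sym; apply: contra_neq an0 => /qa.
rewrite -ln_div ?posrE//.
have h : ln (q / b) <= q / b - 1.
  have := @le_ln1Dx R (q / b - 1); have -> : 1 + (q / b - 1) = q / b by ring.
  apply.
  by have := divr_gt0 qp bp; lra.
apply: (@le_trans _ _ (a * (q / b - 1))); first by rewrite ler_pM2l.
rewrite mulrBr mulr1 lerD2r mulrCA ler_piMr//.
by rewrite ler_pdivrMr// mul1r.
Qed.

(** Gibbs' inequality for the pair, with the marginal of [W] instead of the joint law inside the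
    logarithm: the entropy of [W] alone is bounded without conditional entropies. *)
Lemma gibbs_partition (I J : finType) (W : I -> set T) (V : J -> set T)
    (Q : I -> J -> R) :
  measurable_partition I W -> measurable_partition J V ->
  (forall i j, 0 <= Q i j) -> \sum_i \sum_j Q i j <= 1 ->
  (forall i j, Q i j = 0 -> Pr (W i `&` V j) = 0) ->
  partition_entropy mu W <= - \sum_i \sum_j Pr (W i `&` V j) * ln (Q i j).
Proof.
move=> hW hV Q0 Q1 QP; rewrite /partition_entropy lerN2.
have [mW _ _] := hW; have [mV _ _] := hV.
have E i : Pr (W i) = \sum_j Pr (W i `&` V j) by exact: fine_prob_partition.
have S1 : \sum_i \sum_j Pr (W i `&` V j) = 1.
  rewrite -fine_probT (fine_prob_partition I W setT hW measurableT).
  by apply: eq_bigr => i _; rewrite setTI E.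
rewrite -subr_ge0 -sumrB.
rewrite -[leLHS](subrr 1) -{1}S1.
apply: (@le_trans _ _ (\sum_i \sum_j (Pr (W i `&` V j) - Q i j))).
  under [leRHS]eq_bigr do rewrite sumrB.
  by rewrite sumrB lerD2l lerN2.
apply: ler_sum => i _; rewrite {1}E mulr_suml -sumrB; apply: ler_sum => j _.
have ab : Pr (W i `&` V j) <= Pr (W i).
  by apply: fine_prob_le => //; exact: measurableI.
have := gibbs_term _ _ _ (fine_prob_ge0 _) ab (Q0 i j) (QP i j).
lra.
Qed.

End FineProbability.

(** * Approximation of measurable sets and partitions by finitary ones *)

Section Approximation.
Context {R : realType}.
Variable mu : probability Sigma2 R.

Local Notation Pr A := (fine (mu A)).

Let sdiff (A B : set Sigma2) := (A `\` B) `|` (B `\` A).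

Let sdiff_measurable A B : measurable A -> measurable B -> measurable (sdiff A B).
Proof. by move=> mA mB; apply: measurableU; exact: measurableD. Qed.

Let approximable : set (set Sigma2) := [set A | measurable A /\
  forall eta, 0 < eta -> exists2 B, finitary B & Pr (sdiff A B) <= eta].

Let approximableC A : approximable A -> approximable (~` A).
Proof.
move=> [mA hA]; split; first exact: measurableC.
move=> eta eta0; have [B fB hB] := hA eta eta0; exists (~` B); first exact: finitaryC.
rewrite (_ : sdiff _ _ = sdiff A B)//.
by rewrite /sdiff !setDE !setCK setUC [_ `&` B]setIC [~` B `&` A]setIC.
Qed.

Let approximableI A B : approximable A -> approximable B -> approximable (A `&` B).
Proof.
move=> [mA hA] [mB hB]; split; first exact: measurableI.
move=> eta eta0; have eta2 : 0 < eta / 2 by rewrite divr_gt0.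
have [A' fA hA'] := hA _ eta2; have [B' fB hB'] := hB _ eta2.
have mA' := finitary_measurable _ fA; have mB' := finitary_measurable _ fB.
exists (A' `&` B'); first exact: finitaryI.
apply: (@le_trans _ _ (Pr (sdiff A A' `|` sdiff B B'))).
  apply: fine_prob_le.
  - by apply: sdiff_measurable; exact: measurableI.
  - by apply: measurableU; exact: sdiff_measurable.
  move=> x [[[Ax Bx] /not_andP[]]|[[Ax Bx] /not_andP[]]] h.
  - by left; left.
  - by right; left.
  - by left; right.
  - by right; right.
apply: (le_trans (fine_probU _ _ _ _ _)); [exact: sdiff_measurable|exact: sdiff_measurable|].
by have := lerD hA' hB'; lra.
Qed.

Let approximable_nondecreasing : ndseq_closed approximable.
Proof.
move=> A ndA hA; have mA n : measurable (A n) by have [] := hA n.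
have mU : measurable (\bigcup_n A n) by exact: bigcupT_measurable.
split=> // eta eta0; have eta2 : 0 < eta / 2 by rewrite divr_gt0.
have : fine (mu (A n)) @[n --> \oo] --> fine (mu (\bigcup_n A n)).
  apply: fine_cvg; rewrite fineK ?fin_num_measure//.
  exact: nondecreasing_cvg_mu.
move=> /cvgrPdist_le/(_ _ eta2)[N _ /(_ N (leqnn _)) /= hN].
have [_ /(_ _ eta2)[B fB hB]] := hA N.
have mB := finitary_measurable _ fB.
exists B => //.
have AN : A N `<=` \bigcup_n A n by move=> x Ax; exists N.
have mD : measurable ((\bigcup_n A n) `\` A N) by exact: measurableD.
apply: (@le_trans _ _ (Pr (((\bigcup_n A n) `\` A N) `|` sdiff (A N) B))).
  apply: fine_prob_le.
  - exact: sdiff_measurable.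
  - by apply: measurableU => //; exact: sdiff_measurable.
  move=> x [[Ux nBx]|[Bx nUx]]; last by right; right; split=> // /AN.
  by have [Ax|nAx] := pselect (A N x); [right; left|left].
apply: (le_trans (fine_probU _ _ _ mD (sdiff_measurable _ _ (mA N) mB))).
have : Pr ((\bigcup_n A n) `\` A N) <= eta / 2.
  rewrite measureD//; last by rewrite -ge0_fin_numE ?fin_num_measure.
  rewrite setIidr// fineB ?fin_num_measure//.
  by apply: le_trans hN; exact: ler_norm.
lra.
Qed.

(** The sets approximable in measure form a sigma-algebra that contains the finitary sets. *)
Lemma finitary_approximation A eta : measurable A -> 0 < eta ->
  exists2 B, finitary B & Pr ((A `\` B) `|` (B `\` A)) <= eta.
Proof.
suff : @measurable _ Sigma2 `<=` approximable by move=> /(_ A) h /h[_]; exact.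
rewrite Sigma2_measurableE; apply: smallest_sub; last first.
  move=> B fB; split; first exact: finitary_measurable.
  move=> x x0; exists B => //.
  by rewrite /sdiff setDv setU0 measure0 ltW.
have aT : approximable setT.
  split=> // x x0; exists setT; first exact: finitaryT.
  by rewrite /sdiff setDv setU0 measure0 ltW.
apply/sigma_algebraP => //; split=> //.
move=> B C _ hB hC; rewrite setDE; apply: approximableI => //.
exact: approximableC.
Qed.

(** [c] guesses the cell of [x] from a window, as an index whose finitary approximant contains [x];
    it errs only where some approximant differs from its cell. *)
Lemma finitary_partition_approximation k (A : 'I_k -> set Sigma2) eta :
  finite_measurable_partition A -> 0 < eta ->
  exists m (c : Sigma2 -> 'I_k), [/\
    forall x y, agree_within m x y -> c x = c y,
    measurable [set x | ~ A (c x) x] & Pr [set x | ~ A (c x) x] <= eta].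
Proof.
move=> [mA tA AT] eta0.
have [i0 _] : exists i : 'I_k, A i (fun=> false).
  have : [set: Sigma2] (fun=> false) by [].
  by rewrite -AT => -[i _ Ai]; exists i.
have k0 : 0 < k%:R :> R by rewrite ltr0n; case: (k) i0 => // -[].
have etak : 0 < eta / k%:R by rewrite divr_gt0.
have /choice[B hB] : forall i, exists B, finitary B /\ Pr (sdiff (A i) B) <= eta / k%:R.
  by move=> i; have [B] := finitary_approximation (A i) _ (mA i) etak; exists B.
have mB i : measurable (B i) by apply: finitary_measurable; have [] := hB i.
have /choice[m hm] : forall i, exists m, forall x y : Sigma2,
    agree_within m x y -> B i x -> B i y by move=> i; have [[m]] := hB i; exists m.
pose c (x : Sigma2) := odflt i0 [pick i | `[< B i x >]].
pose M := \max_(i < k) m i.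
have cM x y : agree_within M x y -> c x = c y.
  move=> xy; rewrite /c; congr (odflt _ _); apply: eq_pick => i.
  have xyi : agree_within (m i) x y by apply: agree_within_le xy; exact: leq_bigmax.
  apply/asboolP/asboolP; first exact: hm xyi.
  exact: hm (agree_within_sym _ _ _ xyi).
have mc i : measurable [set x | c x = i].
  by apply: finitary_measurable; exists M => x y /cM /= ->.
have mD : measurable [set x | ~ A (c x) x].
  rewrite (_ : mkset _ = \bigcup_i ([set x | c x = i] `&` ~` A i)).
    apply: fin_bigcup_measurable => [|i _]; first exact: finite_finset.
    by apply: measurableI => //; exact: measurableC.
  apply/seteqP; split=> x /=; first by move=> h; exists (c x).
  by move=> [i _ [/= <-]].
exists M, c; split=> //.
apply: (@le_trans _ _ (Pr (\bigcup_i sdiff (A i) (B i)))).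
  apply: fine_prob_le => //.
    apply: fin_bigcup_measurable => [|i _]; first exact: finite_finset.
    exact: sdiff_measurable.
  move=> x /= nAc; apply: contrapT => nU.
  have hx i : ~ sdiff (A i) (B i) x by move=> h; apply: nU; exists i.
  have xB i : A i x <-> B i x.
    split=> h; apply: contrapT => nh; apply: (hx i); first by left.
    by right.
  apply: nAc; rewrite /c; case: pickP => [i /asboolP/xB//|none /=].
  have : [set: Sigma2] x by [].
  by rewrite -AT => -[i _ /xB Bi]; have /asboolP := none i.
apply: (le_trans (fine_prob_bigcup _ _ _ _)) => [i|]; first exact: sdiff_measurable.
apply: (@le_trans _ _ (\sum_(i < k) eta / k%:R)).
  by apply: ler_sum => i _; have [] := hB i.
by rewrite sumr_const card_ord -[leLHS]mulr_natr divfK ?gt_eqF.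
Qed.

End Approximation.

Lemma ln_prod {R : realType} (I : Type) (r : seq I) (F : I -> R) :
  (forall i, 0 < F i) -> ln (\prod_(i <- r) F i) = \sum_(i <- r) ln (F i).
Proof.
move=> F0; elim: r => [|i r IH]; first by rewrite !big_nil ln1.
by rewrite !big_cons lnM ?posrE// ?IH// prodr_gt0.
Qed.

(** Additivity of entropy for independent letters: the logarithm splits into one term per position,
    and the other positions sum to 1. *)
Lemma sum_prod_ln {R : realType} (J : finType) (q : J -> R) n :
  (forall j, 0 <= q j) -> \sum_j q j = 1 ->
  \sum_(f : {ffun 'I_n -> J}) \prod_i q (f i) * ln (\prod_i q (f i)) =
  n%:R * \sum_j q j * ln (q j).
Proof.
move=> q0 q1.
have E (f : {ffun 'I_n -> J}) : \prod_i q (f i) * ln (\prod_i q (f i)) =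
    \sum_(l < n) \prod_i (q (f i) * (if i == l then ln (q (f i)) else 1)).
  have El l : \prod_i (q (f i) * (if i == l then ln (q (f i)) else 1)) =
      \prod_i q (f i) * ln (q (f l)).
    by rewrite big_split /= -big_mkcond big_pred1_eq.
  rewrite (eq_bigr _ (fun l _ => El l)).
  rewrite -mulr_sumr.
  (* If a factor is zero the logarithm need not split, but both sides vanish. *)
  have [h|/existsNP[l hl]] := pselect (forall i, 0 < q (f i)); first by rewrite ln_prod.
  have ql : q (f l) = 0.
    by apply/eqP; apply: contraT => h; case: hl; rewrite lt_neqAle eq_sym h q0.
  by rewrite [\prod_i _](bigD1 l)//= ql !mul0r.
rewrite (eq_bigr _ (fun f _ => E f)) exchange_big /=.
rewrite mulr_natl -[in RHS](card_ord n) -sumr_const; apply: eq_bigr => l _.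
rewrite -(bigA_distr_bigA (fun i j => q j * (if i == l then ln (q j) else 1))).
rewrite (bigD1 l)//= [X in _ * X]big1 ?mulr1; last first.
  by move=> i /negbTE il; rewrite -[RHS]q1; apply: eq_bigr => j _; rewrite il mulr1.
by apply: eq_bigr => j _; rewrite eqxx.
Qed.

(** * Entropy of the Bernoulli measure *)

Section BernoulliEntropy.
Context {R : realType}.
Variables (p : R) (mu : probability Sigma2 R).
Hypotheses (p_ge0 : 0 <= p) (p_le1 : p <= 1).
Hypothesis mu_box : forall (J : seq int) (v : int -> bool), uniq J ->
  mu [set x | forall i, i \in J -> x i = v i] =
  (\prod_(i <- J) bernoulli_weight p (v i))%:E.

Local Notation Pr A := (fine (mu A)).

Definition bernoulli_entropy : R :=
  - \sum_(b : bool) bernoulli_weight p b * ln (bernoulli_weight p b).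

Let weight_sum : \sum_(b : bool) bernoulli_weight p b = 1.
Proof. by rewrite big_bool /= subrKC. Qed.

Lemma bernoulli_entropy_ge0 : 0 <= bernoulli_entropy.
Proof.
rewrite /bernoulli_entropy -sumrN; apply: sumr_ge0 => b _.
rewrite oppr_ge0 mulr_ge0_le0 ?bernoulli_weight_ge0// ln_le0//.
by case: b => //=; rewrite gerBl.
Qed.

Lemma bernoulli_cylinder n m (f : {ffun 'I_n -> bool}) :
  Pr [set x | forall j : 'I_n, x (j%:Z - m) = f j] =
  \prod_j bernoulli_weight p (f j).
Proof.
pose v (i : int) := nth false (codom f) (absz (i + m)).
have vE (j : 'I_n) : v (j%:Z - m) = f j.
  rewrite /v subrK absz_nat codomE (nth_map j) ?size_enum_ord//.
  by rewrite nth_ord_enum.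
rewrite (_ : mkset _ =
  [set x : Sigma2 | forall i, i \in [seq k%:Z - m | k <- iota 0 n] -> x i = v i]).
  rewrite mu_box; last by rewrite map_inj_uniq ?iota_uniq// => i j /addIr [].
  rewrite big_map (_ : iota 0 n = index_iota 0 n); last by rewrite /index_iota subn0.
  by rewrite big_mkord; apply: eq_bigr => i _; rewrite vE.
apply/seteqP; split=> x /= hx.
  move=> i /mapP[k]; rewrite mem_iota add0n => kn ->.
  by rewrite (hx (Ordinal kn)) -vE.
by move=> j; rewrite hx ?vE//; apply/mapP; exists (val j) => //; rewrite mem_iota /=.
Qed.

Definition coordinate_partition (j : 'I_2) : set Sigma2 :=
  [set x | x 0 = (val j == 1%N)].

Lemma coordinate_partitionP : finite_measurable_partition coordinate_partition.
Proof.
split.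
- move=> j; apply: finitary_measurable; exists 0%N => x y xy.
  by rewrite /coordinate_partition /= xy.
- move=> i j _ _ [x []]; rewrite /coordinate_partition /= => ->; case: i j => [[|[|i]] hi] [[|[|j]] hj] //= _;
  exact: val_inj.
- apply/seteqP; split=> // x _; exists (if x 0 then 1 else 0) => //.
  by rewrite /coordinate_partition /=; case: (x 0).
Qed.

Lemma entropy_coordinate_partition :
  entropy_wrt_partition mu sigma coordinate_partition = bernoulli_entropy.
Proof.
apply: cvg_lim => //; apply: cvg_near_cst; exists 1%N => // n /= n1.
have n0 : n%:R != 0 :> R by rewrite pnatr_eq0 -lt0n.
rewrite /partition_entropy /iterated_join.
pose q (j : 'I_2) := bernoulli_weight p (val j == 1%N).
have E (w : {ffun 'I_n -> 'I_2}) :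
    Pr (\bigcap_(i : 'I_n) (iter i sigma @^-1` coordinate_partition (w i))) = \prod_i q (w i).
  rewrite (_ : \bigcap_(i : 'I_n) _ = [set x | forall j : 'I_n,
      x (j%:Z - 0) = [ffun i => val (w i) == 1%N] j]).
    by rewrite bernoulli_cylinder; apply: eq_bigr => i _; rewrite ffunE.
  apply/seteqP; split=> x /= hx => [j|j _]; have := hx j;
    by rewrite ffunE /coordinate_partition /= iter_sigmaE add0r subr0 => ->.
under eq_bigr do rewrite E.
rewrite (sum_prod_ln _ q).
- rewrite -mulrN mulKf// /bernoulli_entropy big_bool big_ord_recl big_ord1 addrC.
  by [].
- by move=> j; exact: bernoulli_weight_ge0.
- by rewrite big_ord_recl big_ord1 /q /= subrK.
Qed.

Lemma iter_sigma_measurable i (B : set Sigma2) : measurable B ->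
  measurable (iter i sigma @^-1` B).
Proof.
elim: i B => [//|i IH] B mB.
rewrite (_ : _ @^-1` B = iter i sigma @^-1` (sigma @^-1` B))//.
by apply: IH; have := measurable_sigma measurableT _ mB; rewrite setTI.
Qed.

Lemma invariant_iter_sigma i (B : set Sigma2) : measurable B ->
  mu (iter i sigma @^-1` B) = mu B.
Proof.
have inv := bernoulli_invariant p mu mu_box.
elim: i B => [//|i IH] B mB.
rewrite (_ : _ @^-1` B = iter i sigma @^-1` (sigma @^-1` B))//.
rewrite IH; first exact: inv.
by have := measurable_sigma measurableT _ mB; rewrite setTI.
Qed.

Lemma iterated_join_partition k (A : 'I_k -> set Sigma2) n :
  finite_measurable_partition A ->
  measurable_partition _ (@iterated_join _ _ sigma k A n).
Proof.
move=> [mA tA AT]; split.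
- move=> w; apply: fin_bigcap_measurable => [|i _]; first exact: finite_finset.
  exact: iter_sigma_measurable.
- move=> w w' _ _ [x [hw hw']]; apply/ffunP => i.
  by apply: tA => //; exists (iter i sigma x); split; [exact: hw|exact: hw'].
- apply/seteqP; split=> // x _.
  have /choice[c hc] : forall y, exists i, A i y.
    by move=> y; have : [set: Sigma2] y by []; rewrite -AT => -[i _ Ai]; exists i.
  by exists [ffun i : 'I_n => c (iter i sigma x)] => // i _; rewrite /= ffunE.
Qed.

Lemma cylinder_partition n (m : int) : measurable_partition {ffun 'I_n -> bool}
  (fun f => [set x : Sigma2 | forall j : 'I_n, x (j%:Z - m) = f j]).
Proof.
split.
- move=> f; rewrite (_ : mkset _ = \bigcap_(j : 'I_n) [set x : Sigma2 | x (j%:Z - m) = f j]).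
    apply: fin_bigcap_measurable => [|j _]; first exact: finite_finset.
    apply: finitary_measurable; exists (absz (j%:Z - m)) => x y xy /=.
    by rewrite xy.
  by apply/seteqP; split=> x /= hx => [j _|j]; exact: hx.
- by move=> f g _ _ [x [/= hf hg]]; apply/ffunP => j; rewrite -hf -hg.
- apply/seteqP; split=> // x _; exists [ffun j : 'I_n => x (j%:Z - m)] => // j.
  by rewrite ffunE.
Qed.

Section UpperBound.
Variables (k : nat) (A : 'I_k -> set Sigma2).
Hypothesis hA : finite_measurable_partition A.
Variables (m : nat) (c : Sigma2 -> 'I_k) (eta delta : R).
Hypothesis cm : forall x y, agree_within m x y -> c x = c y.
Hypothesis mD : measurable [set x | ~ A (c x) x].
Hypothesis PrD : Pr [set x | ~ A (c x) x] <= eta.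
Hypotheses (delta_gt0 : 0 < delta) (delta_lt1 : delta < 1).

Let k_gt0 : (0 < k)%N.
Proof. by have := c (fun=> false) => -[j jk]; exact: leq_ltn_trans jk. Qed.

Let kR_ge1 : 1 <= k%:R :> R. Proof. by rewrite ler1n. Qed.
Let kR_gt0 : 0 < k%:R :> R. Proof. by rewrite ltr0n. Qed.

(* The conditional law of the itinerary letter given its coded value used in
   Gibbs' inequality. *)
Let kappa (a b : 'I_k) : R := if a == b then 1 - delta else delta / k%:R.

Let kappa_gt0 a b : 0 < kappa a b.
Proof. by rewrite /kappa; case: ifP => _; rewrite ?subr_gt0// divr_gt0. Qed.

Let kappa_sum b : \sum_a kappa a b <= 1.
Proof.
apply: (@le_trans _ _ (\sum_(a < k) ((if a == b then 1 - delta else 0) + delta / k%:R))).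
  apply: ler_sum => a _; rewrite /kappa; case: eqP => _; last by rewrite add0r.
  by rewrite lerDl divr_ge0 ?ltW.
rewrite big_split /= -big_mkcond big_pred1_eq sumr_const card_ord.
by rewrite -[X in _ + X]mulr_natr divfK ?gt_eqF// subrK.
Qed.

Let kappa_ln a b :
  - ln (kappa a b) <= - ln (1 - delta) + (a != b)%:R * ln (k%:R / delta).
Proof.
rewrite /kappa; case: eqP => _ /=; first by rewrite mul0r addr0.
rewrite mul1r -lnV ?posrE ?divr_gt0// invf_div lerDr oppr_ge0 ln_le0//.
by rewrite gerBl ltW.
Qed.

Variable n : nat.
(** Guessing [n] successive letters through windows of radius [m] reads the coordinates from [-m] to
    [n + m - 1]. *)
Let N := (n + 2 * m)%N.
Let W := @iterated_join _ _ sigma k A n.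
Let V (f : {ffun 'I_N -> bool}) : set Sigma2 :=
  [set x | forall j : 'I_N, x (j%:Z - m%:Z) = f j].
Let dec (f : {ffun 'I_N -> bool}) : Sigma2 :=
  fun i => nth false (codom f) (absz (i + m%:Z)).
Let code (f : {ffun 'I_N -> bool}) (i : 'I_n) : 'I_k := c (iter i sigma (dec f)).
Let weight (f : {ffun 'I_N -> bool}) : R := \prod_j bernoulli_weight p (f j).
Let Q (w : {ffun 'I_n -> 'I_k}) f := weight f * \prod_i kappa (w i) (code f i).

Let codeE f x (i : 'I_n) : V f x -> c (iter i sigma x) = code f i.
Proof.
move=> Vx; apply: cm => l lm; rewrite !iter_sigmaE /dec.
have jN : (absz (l + i%:Z + m%:Z)%R < N)%N.
  by have := ltn_ord i; rewrite /N; lia.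
have E : l + i%:Z = (absz (l + i%:Z + m%:Z))%:Z - m%:Z by have := ltn_ord i; lia.
rewrite {1}E (Vx (Ordinal jN)) codomE (nth_map (Ordinal jN)) ?size_enum_ord//.
congr (f _); apply: val_inj => /=.
by rewrite nth_enum_ord.
Qed.

Let weight_ge0 f : 0 <= weight f.
Proof. by apply: prodr_ge0 => j _; exact: bernoulli_weight_ge0. Qed.

Let weight_sum1 : \sum_f weight f = 1.
Proof.
rewrite /weight -(bigA_distr_bigA (fun (i : 'I_N) b => bernoulli_weight p b)).
by rewrite big1.
Qed.

Let PrV f : Pr (V f) = weight f.
Proof. exact: bernoulli_cylinder. Qed.

Let Q_sum : \sum_w \sum_f Q w f <= 1.
Proof.
rewrite exchange_big /= -weight_sum1; apply: ler_sum => f _.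
rewrite /Q -mulr_sumr -[leRHS]mulr1 ler_wpM2l//.
rewrite -(bigA_distr_bigA (fun i a => kappa a (code f i))).
apply: prodr_ile1 => i _; rewrite kappa_sum andbT.
by apply: sumr_ge0 => a _; exact: ltW.
Qed.

Let P w f := Pr (W w `&` V f).
Let hW : measurable_partition _ W := iterated_join_partition k A n hA.
Let hV : measurable_partition _ V := cylinder_partition N m%:Z.

Let mWV w f : measurable (W w `&` V f).
Proof. by have [mW _ _] := hW; have [mV _ _] := hV; exact: measurableI. Qed.

Let P_ge0 w f : 0 <= P w f. Proof. exact: fine_prob_ge0. Qed.

Let sumP_w f : \sum_w P w f = weight f.
Proof.
have [mV _ _] := hV.
rewrite -PrV (fine_prob_partition mu _ W _ hW (mV f)).
by apply: eq_bigr => w _; rewrite /P setIC.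
Qed.

Let P_le_weight w f : P w f <= weight f.
Proof.
by rewrite -(sumP_w f) (bigD1 w)//= lerDl sumr_ge0.
Qed.

(** By invariance a wrong guess at time [i] is as likely as at time 0. *)
Let disagreement i : \sum_w \sum_f P w f * (w i != code f i)%:R <= eta.
Proof.
pose D := iter i sigma @^-1` [set x | ~ A (c x) x].
have mDi : measurable D by exact: iter_sigma_measurable.
have [mW _ _] := hW; have [mV _ _] := hV; have [mA tA _] := hA.
have PrDi : Pr D <= eta by rewrite /D invariant_iter_sigma.
apply: le_trans PrDi; rewrite (fine_prob_partition mu _ W _ hW mDi).
apply: ler_sum => w _; have mDW : measurable (D `&` W w) by exact: measurableI.
rewrite (fine_prob_partition mu _ V _ hV mDW); apply: ler_sum => f _.
case: eqP => [_|wf] /=; first by rewrite mulr0 fine_prob_ge0.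
rewrite mulr1; apply: fine_prob_le => //; first exact: measurableI.
move=> x [Wx Vx]; split=> //; split=> //= Ac; apply: wf.
rewrite -(codeE f x i Vx); apply: tA => //.
by exists (iter i sigma x); split; [exact: (Wx i)|].
Qed.

Let P_ln w f : - (P w f * ln (Q w f)) <= - (P w f * ln (weight f)) +
  \sum_(i < n) (P w f * - ln (1 - delta) +
    P w f * (w i != code f i)%:R * ln (k%:R / delta)).
Proof.
have [->|P0] := eqVneq (P w f) 0.
  by rewrite !mul0r big1 ?addr0// => i _; rewrite !mul0r addr0.
have Pgt0 : 0 < P w f by rewrite lt_neqAle eq_sym P0 P_ge0.
have wgt0 : 0 < weight f by exact: lt_le_trans (P_le_weight w f).
rewrite /Q lnM ?posrE//; last by apply: prodr_gt0.
rewrite ln_prod// mulrDr opprD lerD2l mulr_sumr -sumrN.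
apply: ler_sum => i _; rewrite -mulrN -mulrA -mulrDr ler_wpM2l//.
Qed.

(** The cross-entropy with [Q] splits into the entropy of the window, [- ln (1 - delta)] for each
    letter, and [ln (k / delta)] for each wrong guess, of probability at most [eta]. *)
Lemma partition_entropy_le : partition_entropy mu W <=
  N%:R * bernoulli_entropy + n%:R * (- ln (1 - delta) + eta * ln (k%:R / delta)).
Proof.
have Q0 w f : 0 <= Q w f.
  by rewrite mulr_ge0// prodr_ge0// => i _; exact: ltW.
have QP w f : Q w f = 0 -> P w f = 0.
  move=> /eqP; rewrite mulf_eq0 => /orP[/eqP w0|/prodf_eq0[i _]].
    by apply/le_anti; rewrite P_ge0 -w0 P_le_weight.
  by rewrite gt_eqF.
apply: (le_trans (gibbs_partition mu _ _ W V Q hW hV Q0 Q_sum QP)).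
rewrite -sumrN; under eq_bigr do rewrite -sumrN.
apply: (le_trans (ler_sum _ (fun w _ => ler_sum _ (fun f _ => P_ln w f)))).
under eq_bigr do rewrite big_split /= sumrN.
rewrite big_split /= sumrN; apply: lerD.
  rewrite exchange_big /=.
  under eq_bigr do rewrite -mulr_suml sumP_w.
  rewrite /weight (sum_prod_ln _ (bernoulli_weight p)) ?weight_sum//.
    by rewrite -mulrN.
  by move=> b; exact: bernoulli_weight_ge0.
under eq_bigr do rewrite exchange_big /=.
rewrite exchange_big /= [leRHS]mulr_natl -[in leRHS](card_ord n) -sumr_const.
apply: ler_sum => i _.
under eq_bigr do rewrite big_split /= -mulr_suml -mulr_suml.
rewrite big_split /= -mulr_suml -mulr_suml; apply: lerD.
  by rewrite exchange_big /= (eq_bigr _ (fun f _ => sumP_w f)) weight_sum1 mul1r.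
rewrite ler_wpM2r//.
rewrite ln_ge0// ler_pdivlMr// mul1r; apply: le_trans kR_ge1; exact: ltW.
Qed.

End UpperBound.

Lemma entropy_wrt_partition_le k (A : 'I_k -> set Sigma2) :
  finite_measurable_partition A ->
  entropy_wrt_partition mu sigma A <= bernoulli_entropy.
Proof.
move=> hA; rewrite /entropy_wrt_partition.
set u := (fun n : nat => _).
have H0 := bernoulli_entropy_ge0.
(* Without convergence [limn] takes its default value 0, and nonnegativity of the entropy
   suffices. *)
have [cu|/dvgP ->] := pselect (cvgn u); last exact: H0.
apply/ler_addgt0Pl => eps eps0.
(* One third of [eps] each goes to the noise [- ln (1 - delta)], to the wrong guesses [eta * l], and
   to the [2 * m] extra letters of the window once [n] is large. *)
pose delta := 1 - expR (- (eps / 3)).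
have d0 : 0 < delta by rewrite subr_gt0 expR_lt1; lra.
have d1 : delta < 1 by rewrite gtrBl expR_gt0.
have ld : - ln (1 - delta) = eps / 3 by rewrite opprB addrC subrK expRK opprK.
pose l := ln (k%:R / delta).
pose eta := eps / 3 / (`|l| + 1).
have eta0 : 0 < eta by rewrite !divr_gt0// ltr_wpDl.
have le : eta * l <= eps / 3.
  rewrite mulrAC ler_pdivrMr ?ltr_wpDl// ler_wpM2l//; first by rewrite divr_ge0// ltW.
  by apply: (le_trans (ler_norm _)); rewrite lerDl.
have [m [c [cm mD PrD]]] := finitary_partition_approximation mu k A eta hA eta0.
have [M hM] : exists M : nat, (2 * m)%:R * bernoulli_entropy / (eps / 3) < M%:R.
  by exists (Num.truncn ((2 * m)%:R * bernoulli_entropy / (eps / 3))).+1; exact: truncnS_gt.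
apply: limr_le => //; exists M.+1 => // n /= Mn.
have n0 : 0 < n%:R :> R by rewrite ltr0n; lia.
have nC : (2 * m)%:R * bernoulli_entropy < n%:R * (eps / 3).
  rewrite -ltr_pdivrMr ?divr_gt0//; apply: lt_le_trans hM _.
  by rewrite ler_nat; lia.
rewrite /u ler_pdivrMl//.
apply: (le_trans (partition_entropy_le k A hA m c eta delta cm mD PrD d0 d1 n)).
rewrite ld natrD mulrDl mulrDr -/l.
have : n%:R * (eta * l) <= n%:R * (eps / 3) by rewrite ler_pM2l.
lra.
Qed.

Lemma bernoulli_metric_entropy : metric_entropy mu sigma = bernoulli_entropy%:E.
Proof.
apply/eqP; rewrite eq_le; apply/andP; split.
  apply: ge_ereal_sup => _ [k [A [hA ->]]].
  by rewrite lee_fin entropy_wrt_partition_le.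
apply: ereal_sup_ubound; exists 2%N, coordinate_partition.
by split; [exact: coordinate_partitionP|rewrite entropy_coordinate_partition].
Qed.

End BernoulliEntropy.

(** Intermediate values between a small [a] and [1 / 2], where the entropy is [ln 2]. Starting at
    [a > 0] stays where [ln] is continuous; [h = 0] is realised by [p = 0]. *)
Lemma bernoulli_entropy_surj {R : realType} (h : R) : 0 <= h -> h < ln 2 ->
  exists p, [/\ 0 <= p, p < 1 & bernoulli_entropy p = h].
Proof.
move=> h0 h2.
have HE (x : R) : bernoulli_entropy x = - (x * ln x + (1 - x) * ln (1 - x)).
  by rewrite /bernoulli_entropy big_bool.
have [->|hn0] := eqVneq h 0.
  by exists 0; split=> //; rewrite HE mul0r subr0 ln1 mulr0 addr0 oppr0.
have hp : 0 < h by rewrite lt_neqAle eq_sym hn0.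
(* [a] is a square so that [- ln s <= s^-1] gives [- (a * ln a) <= 2 * s]; the other term is at most
   [a <= s / 2], and [3 * s <= h]. *)
pose s := Num.min (h / 3) (1 / 2); pose a := s ^+ 2.
have s0 : 0 < s by rewrite lt_min; apply/andP; split; lra.
have sh : s <= h / 3 by rewrite ge_min lexx.
have s2 : s <= 1 / 2 by rewrite ge_min lexx orbT.
have a0 : 0 < a by rewrite exprn_gt0.
have as2 : a <= s / 2 by rewrite /a expr2 ler_wpM2l ?(ltW s0)//; lra.
have Ha : bernoulli_entropy a <= h.
  have h1 : - (a * ln a) <= 2 * s.
    have := @ln_sublinear R s^-1; rewrite invr_gt0 => /(_ s0).
    rewrite lnV ?posrE// => /ltW ls.
    have -> : - (a * ln a) = 2 * (s * (s * - ln s)).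
      by rewrite /a expr2 lnM ?posrE//; ring.
    rewrite ler_pM2l// ler_piMr ?(ltW s0)//.
    have : s * - ln s <= s * s^-1 by rewrite ler_pM2l.
    by rewrite divff ?gt_eqF.
  have q0 : 0 < 1 - a by lra.
  have h3 : - ((1 - a) * ln (1 - a)) <= a.
    have := @le_ln1Dx R ((1 - a)^-1 - 1).
    have -> : 1 + ((1 - a)^-1 - 1) = (1 - a)^-1 by ring.
    rewrite lnV ?posrE// => H.
    have {}H : - ln (1 - a) <= (1 - a)^-1 - 1.
      apply: H; have : 0 < (1 - a)^-1 by rewrite invr_gt0.
      lra.
    have : (1 - a) * - ln (1 - a) <= (1 - a) * ((1 - a)^-1 - 1) by rewrite ler_pM2l.
    by rewrite mulrN mulrBr divff ?gt_eqF//; lra.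
  by rewrite HE opprD; lra.
have Hhalf : bernoulli_entropy (1 / 2 : R) = ln 2.
  rewrite HE (_ : 1 - 1 / 2 = 1 / 2 :> R); last by field.
  by rewrite div1r lnV ?posrE//; field.
have [|||c] := @IVT R bernoulli_entropy a (1 / 2) h.
- lra.
- apply: continuous_in_subspaceT => x; rewrite inE /= in_itv /= => /andP[ax x1].
  have x0 : 0 < x by exact: lt_le_trans ax.
  have y0 : 0 < 1 - x by lra.
  rewrite (_ : bernoulli_entropy = fun x => - (x * ln x + (1 - x) * ln (1 - x))); last exact/funext.
  have cs : (1 - z : R) @[z --> x] --> 1 - x by apply: cvgB; [exact: cvg_cst|exact: cvg_id].
  apply: cvgN; apply: cvgD; apply: cvgM => //.
  - exact: continuous_ln.
  - by apply: (cvg_comp _ _ cs); exact: continuous_ln.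
- rewrite Hhalf; apply/andP; split; first by rewrite ge_min Ha.
  by rewrite le_max (ltW h2) orbT.
rewrite in_itv /= => /andP[ac c1] Hc; exists c; split=> //; lra.
Qed.

(* Measures are set functions on all subsets, so two of them are the same
   measure when they agree on the measurable sets. *)
Theorem mainTheorem2 (R : realType) (H : completeNormedModType R)
    (ip : {dot H for idfun}) (e : int -> H)
    (ipP : norm_from_dot ip) (eP : orthonormal_basis ip e)
    (h : R) (h_ge0 : 0 <= h) (h_lt : h < ln 2) :
  exists L : {linear H -> H} * {linear H -> H},
    shift_pairs e L /\
    exists mu : probability Sigma2 R,
      [/\ maximising_measure L mu,
          forall nu : probability Sigma2 R, maximising_measure L nu ->
            forall A : set Sigma2, measurable A -> nu A = mu A &
          metric_entropy mu sigma = h%:E].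
Proof.
have [p [p_ge0 p_lt1 pH]] := bernoulli_entropy_surj h h_ge0 h_lt.
have p_le1 := ltW p_lt1.
have [L [LW L0 L_ge L_le]] := shift_pair_exists ip e ipP eP p p_ge0 p_le1.
have [mu mu_box] := bernoulli_measure p p_ge0 p_lt1.
exists L; split=> //; exists mu; split.
- exact: (bernoulli_maximising p p_ge0 p_le1 L L0 L_ge L_le mu mu_box).
- move=> nu; exact: (bernoulli_maximising_unique p p_ge0 p_le1 L L0 L_ge L_le mu mu_box).
- by rewrite (bernoulli_metric_entropy p mu p_ge0 p_le1 mu_box) pH.
Qed.
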